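(* Let $K_+\subset S^3$ be a knot with a distinguished positive crossing and let $K_-$ be the knot obtained from $K_+$ by changing that crossing. Represent $K_+$ and $K_-$ by grid diagrams $\mathbb{G}_+$ and $\mathbb{G}_-$ (of grid number $n$) that differ by a cross-commutation of columns. Then there exist filtered chain maps $$\mathcal{C}_-:\mathcal{GC}^-(\mathbb{G}_+)\to\mathcal{GC}^-(\mathbb{G}_-)\quad\text{and}\quad \mathcal{C}_+:\mathcal{GC}^-(\mathbb{G}_-)\to\mathcal{GC}^-(\mathbb{G}_+),$$ where $\mathcal{C}_-$ and $\mathcal{C}_+$ are homogeneous of degree $(0,0)$ and $(-2,-1)$ respectively, such that $\mathcal{C}_-\circ\mathcal{C}_+$ and $\mathcal{C}_+\circ\mathcal{C}_-$ are filtered chain homotopic to multiplication by $V_1$.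
   Context: Throughout $\mathbb{F}=\mathbb{Z}/2\mathbb{Z}$. Grid diagrams. A (planar) grid diagram $\mathbb{G}$ of grid number $n$ is an $n\times n$ grid with $n$ squares marked $X$ and $n$ squares marked $O$, such that each row and each column contains exactly one $X$ and exactly one $O$, and no square contains both. It specifies an oriented link: draw segments from $X$ to $O$ in each column and from $O$ to $X$ in each row, vertical segments crossing over horizontal ones. Here all links are knots. Write $\mathbb{O}=\{O_1,\dots,O_n\}$ and $\mathbb{X}$ for the sets of markings. Identifying opposite sides gives a toroidal grid diagram with horizontal circles $\alpha_1,\dots,\alpha_n$ and vertical circles $\beta_1,\dots,\beta_n$. Cross-commutation of columns. Two grid diagrams are related by a cross-commutation of columns if one is obtained from the other by interchanging two consecutive columns whose corresponding intervals (between the $X$ and the $O$ of the column) have interiors that intersect nontrivially, with neither interval contained in the other. The two grids $\mathbb{G}_+,\mathbb{G}_-$ are drawn on the same torus with the same markings, so their $O$-markings carry common labels; the two $O$-markings in the interchanged columns are labelled $O_1$ and $O_2$, with $O_1$ above $O_2$ in the diagram. The variable $V_i$ corresponds to $O_i$. Grid states and rectangles. A grid state is a set $\mathbf{x}$ of $n$ points with exactly one on each $\alpha_j$ and one on each $\beta_j$; $\mathbf{S}(\mathbb{G})$ is the set of grid states. A rectangle from $\mathbf{x}$ to $\mathbf{y}$ is an embedded disk $r$ in the torus whose boundary is a union of four arcs, each in some $\alpha_j$ or $\beta_j$, such that at each corner $r$ contains exactly one of the four local quadrants, all corners lie in $\mathbf{x}\cup\mathbf{y}$, and, if $\partial_\alpha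 r$ is the part of the (oriented) boundary on the $\alpha$-circles, $\partial(\partial_\alpha r)=\mathbf{y}-\mathbf{x}$ as formal sums of points. It is empty if its interior contains no point of $\mathbf{x}$ or $\mathbf{y}$; $\mathrm{Rect}^\circ(\mathbf{x},\mathbf{y})$ is the set of empty rectangles. Gradings. Place the grid in the plane. For finite planar point sets $P,Q$ let $I(P,Q)$ be the number of pairs $p\in P$, $q\in Q$ with both coordinates of $p$ strictly less than those of $q$, let $\mathcal{J}(P,Q)=\frac12(I(P,Q)+I(Q,P))$, and extend bilinearly to formal sums and differences. The Maslov function is $M(\mathbf{x})=M_{\mathbb{O}}(\mathbf{x})=\mathcal{J}(\mathbf{x}-\mathbb{O},\mathbf{x}-\mathbb{O})+1$, $M_{\mathbb{X}}$ is defined likewise with $\mathbb{X}$ in place of $\mathbb{O}$, and the Alexander function is $A(\mathbf{x})=\frac12(M_{\mathbb{O}}(\mathbf{x})-M_{\mathbb{X}}(\mathbf{x}))-\frac{n-1}{2}$. Extend by $M(V_1^{k_1}\cdots V_n^{k_n}\mathbf{x})=M(\mathbf{x})-2\sum k_i$ and $A(V_1^{k_1}\cdots V_n^{k_n}\mathbf{x})=A(\mathbf{x})-\sum k_i$. Filtered grid complex. $\mathcal{GC}^-(\mathbb{G})$ is the free $\mathbb{F}[V_1,\dots,V_n]$-module on $\mathbf{S}(\mathbb{G})$ with differential $$\partial^-\mathbf{x}=\sum_{\mathbf{y}\in\mathbf{S}(\mathbb{G})}\ \sum_{r\in\mathrm{Rect}^\circ(\mathbf{x},\mathbf{y})}V_1^{O_1(r)}\cdots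 V_n^{O_n(r)}\,\mathbf{y},$$ where $O_i(r)$ is $1$ if $O_i\in r$ and $0$ otherwise. It is graded by $M$ (the degree $d$ part $\mathcal{C}_d$ is the $\mathbb{F}$-span of the elements $V_1^{k_1}\cdots V_n^{k_n}\mathbf{x}$ with $M=d$) and filtered by $A$ ($\mathcal{F}_s\mathcal{C}$ is the $\mathbb{F}$-span of the elements $V_1^{k_1}\cdots V_n^{k_n}\mathbf{x}$ with $A\le s$). Maps. All maps are $\mathbb{F}[V_1,\dots,V_n]$-module maps. A map $f:\mathcal{C}\to\mathcal{C}'$ is homogeneous of degree $(m,t)$ if $f(\mathcal{C}_d)\subseteq\mathcal{C}'_{d+m}$ and $f(\mathcal{F}_s\mathcal{C})\subseteq\mathcal{F}_{s+t}\mathcal{C}'$ for all $d,s$; it is filtered if $f(\mathcal{F}_s\mathcal{C})\subseteq\mathcal{F}_s\mathcal{C}'$ for all $s$. A filtered chain homotopy from an endomorphism $g$ to multiplication by $V_1$ is a module map $H$, homogeneous of degree $(-1,0)$ (so preserving the filtration), with $g-V_1=\partial^-H+H\partial^-$. *)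

(* Defs.v *)
From HB Require Import structures.
From mathcomp Require Import all_boot all_order all_fingroup all_algebra.
From mathcomp.multinomials Require Import mpoly.

Set Implicit Arguments.
Unset Strict Implicit.
Unset Printing Implicit Defensive.

Import GRing.Theory Num.Theory.
Local Open Scope ring_scope.

(* Columns are numbered from left to right and rows from bottom to top.
   [gO G c] and [gX G c] are the rows of the O and of the X of column c. *)
Record grid (n : nat) := Grid {
  gO : 'S_n;
  gX : 'S_n;
  grid_disjoint : forall c : 'I_n, gO c != gX c
}.

Section GridDiagrams.
Variable n : nat.
Implicit Types (G : grid n) (x y : 'S_n) (c i j r : 'I_n).

Definition colO G r : 'I_n := (gO G)^-1%g r.
Definition colX G r : 'I_n := (gX G)^-1%g r.

(* Traversing the link from the X of a column to its O, and then along the row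
   to the next X, sends column c to column colX (gO c); the components of the
   link are the cycles of this permutation. *)
Definition is_knot G : Prop := #|porbits (gO G * (gX G)^-1)%g| = 1%N.

Definition strictly_between (k a b : nat) : bool := (minn a b < k < maxn a b)%N.

Definition is_crossing G c r : bool :=
  strictly_between r (gX G c) (gO G c) && strictly_between c (colO G r) (colX G r).

(* The over-strand is the vertical one, directed from X to O, and the horizontal
   under-strand is directed from O to X.  By the right-hand rule the crossing is
   positive when these directions are (up, left) or (down, right). *)
Definition positive_at G c r : bool :=
  (gX G c < gO G c)%N != (colO G r < colX G r)%N.

Definition col_lo G c : nat := minn (gX G c) (gO G c).
Definition col_hi G c : nat := maxn (gX G c) (gO G c).

Definition interiors_meet G i j : bool :=
  (maxn (col_lo G i) (col_lo G j) < minn (col_hi G i) (col_hi G j))%N.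

Definition interval_contained G i j : bool :=
  (col_lo G j <= col_lo G i)%N && (col_hi G i <= col_hi G j)%N.

Definition cross_commutation (G G' : grid n) i j : Prop :=
  [/\ nat_of_ord j = i.+1,
      interiors_meet G i j,
      ~~ interval_contained G i j && ~~ interval_contained G j i,
      forall c, gO G' c = gO G (tperm i j c)
    & forall c, gX G' c = gX G (tperm i j c)].

(* The crossings between the strands through columns i and j: the vertical
   segment of one of the columns crosses over a horizontal segment issuing from
   a marking of the other one. *)
Definition strand_crossing G i j c r : bool :=
  is_crossing G c r &&
  (((c == i) && (r \in [:: gO G j; gX G j])) ||
   ((c == j) && (r \in [:: gO G i; gX G i]))).

(* According to the sides to which the horizontal segments leave, two diagrams
   that differ by a cross-commutation have 1 and 1, or 2 and 0, or 0 and 2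
   crossings between the two strands.  In the last two cases the two crossings
   form a clasp, and changing either of them gives the other diagram up to a
   Reidemeister move.  So G' is obtained from G by changing a positive crossing
   exactly when the crossings between the two strands are positive in G and
   negative in G'. *)
Definition changes_positive_crossing (G G' : grid n) i j : Prop :=
  (forall c r, strand_crossing G i j c r -> positive_at G c r) /\
  (forall c r, strand_crossing G' i j c r -> ~~ positive_at G' c r).

(* A grid state x is given by its points (c, x c), where c stands for the
   vertical circle on the left of column c and x c for the horizontal circle at
   the bottom of row x c.  An O is labelled by its row, so that the variable V_r
   corresponds to the O in row r; a commutation of columns preserves labels. *)

Definition upperO G i j : 'I_n :=
  if (gO G i < gO G j)%N then gO G j else gO G i.

(* Toroidal rectangles are given by their SW corner (i, a) and NE corner
   (j, b). *)
Definition rect := (('I_n * 'I_n) * ('I_n * 'I_n))%type.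

(* The number of steps from i to k in the positive direction of the circle. *)
Definition cdist i j : nat := ((j + n - i) %% n)%N.

Definition in_interior (R : rect) c r : bool :=
  let: ((i, a), (j, b)) := R in
  (0 < cdist i c < cdist i j)%N && (0 < cdist a r < cdist a b)%N.

(* The square in column c and row r lies in R. *)
Definition square_in (R : rect) c r : bool :=
  let: ((i, a), (j, b)) := R in
  (cdist i c < cdist i j)%N && (cdist a r < cdist a b)%N.

(* With the boundary oriented counterclockwise, the condition
   d(d_alpha R) = y - x says that the SW and NE corners lie in x, that the SE
   and NW corners lie in y, and that x and y have the same other points. *)
Definition connects (R : rect) x y : bool :=
  let: ((i, a), (j, b)) := R in
  [&& i != j, x i == a, x j == b, y i == b, y j == a
    & [forall k, (k != i) && (k != j) ==> (x k == y k)]].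

Definition empty_rects x y : {set rect} :=
  [set R | connects R x y
         & [forall k, ~~ in_interior R k (x k) && ~~ in_interior R k (y k)]].

(* Planar coordinates are doubled, so that the markings, which lie at centres
   of squares, have odd integral coordinates. *)
Definition state_points x : seq (nat * nat) :=
  [seq (c.*2, (x c).*2) | c : 'I_n <- enum 'I_n].

Definition mark_points (m : 'S_n) : seq (nat * nat) :=
  [seq (c.*2.+1, (m c).*2.+1) | c : 'I_n <- enum 'I_n].

Definition Icount (P Q : seq (nat * nat)) : nat :=
  (\sum_(p <- P) \sum_(q <- Q) ((p.1 < q.1) && (p.2 < q.2)))%N.

Definition Jform (P Q : seq (nat * nat)) : rat :=
  (Icount P Q + Icount Q P)%:R / 2%:R.

(* J(P - Q, P - Q) *)
Definition Jdiff (P Q : seq (nat * nat)) : rat :=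
  Jform P P - Jform P Q - Jform Q P + Jform Q Q.

Definition Mfun (m : 'S_n) x : rat :=
  Jdiff (state_points x) (mark_points m) + 1.

Definition maslov G x : rat := Mfun (gO G) x.

Definition alexander G x : rat :=
  (Mfun (gO G) x - Mfun (gX G) x) / 2%:R - (n%:R - 1) / 2%:R.

Definition maslov_mon G (k : 'X_{1..n}) x : rat := maslov G x - 2%:R * (mdeg k)%:R.
Definition alexander_mon G (k : 'X_{1..n}) x : rat := alexander G x - (mdeg k)%:R.

End GridDiagrams.

Notation VRing n := {mpoly 'F_2[n]}.

(* The free F[V_1, ..., V_n]-module on the grid states, as the module of
   functions from grid states to coefficients. *)
Notation GC n := {ffun 'S_n -> (VRing n)^o}.

Definition generator (n : nat) (x : 'S_n) : GC n := [ffun y => (y == x)%:R].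

Definition rect_weight (n : nat) (G : grid n) (R : rect n) : VRing n :=
  \prod_(l < n) 'X_l ^+ square_in R (colO G l) l.

Definition differential_gen (n : nat) (G : grid n) (x : 'S_n) : GC n :=
  \sum_(y : 'S_n) \sum_(R in empty_rects x y) rect_weight G R *: generator y.

Definition differential (n : nat) (G : grid n) (v : GC n) : GC n :=
  \sum_(x : 'S_n) (v x : VRing n) *: differential_gen G x.

(* The elements V^k x form an F-basis, so the F-span of some of them consists of
   the elements supported on them. *)
Definition degree_part (n : nat) (G : grid n) (d : rat) (v : GC n) : Prop :=
  forall (x : 'S_n) (k : 'X_{1..n}),
    k \in msupp (v x : VRing n) -> maslov_mon G k x = d.

Definition filtration (n : nat) (G : grid n) (s : rat) (v : GC n) : Prop :=
  forall (x : 'S_n) (k : 'X_{1..n}),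
    k \in msupp (v x : VRing n) -> alexander_mon G k x <= s.

(* In what follows f is a map from the complex of G to the complex of G'. *)

Definition chain_map (n : nat) (G G' : grid n) (f : GC n -> GC n) : Prop :=
  forall v, differential G' (f v) = f (differential G v).

Definition filtered (n : nat) (G G' : grid n) (f : GC n -> GC n) : Prop :=
  forall (s : rat) v, filtration G s v -> filtration G' s (f v).

(* The gradings are rational numbers by definition, so d and s are rational. *)
Definition homogeneous (n : nat) (G G' : grid n) (m t : rat)
    (f : GC n -> GC n) : Prop :=
  (forall (d : rat) v, degree_part G d v -> degree_part G' (d + m) (f v)) /\
  (forall (s : rat) v, filtration G s v -> filtration G' (s + t) (f v)).

Definition filtered_homotopic_to_mul (n : nat) (G : grid n)
    (a : VRing n) (g : GC n -> GC n) : Prop :=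
  exists H : {linear GC n -> GC n},
    homogeneous G G (-1) 0 H /\
    forall v, g v - a *: v = differential G (H v) + H (differential G v).

(* Main.v *)
Require Import Defs.
From HB Require Import structures.
From mathcomp Require Import all_boot all_order all_fingroup all_algebra.
From mathcomp.multinomials Require Import mpoly.
From mathcomp Require Import zify ring lra.

(** Let [b] be the circle between the two columns of G+ and [c] the corresponding
    circle of G-, and number states of both diagrams by permutations.  The maps
    count pentagons with a vertex at an intersection point of [b] and [c] just
    below (for C-) or just above (for C+) the X of the right column of G+, in row
    v.  Such a pentagon is a rectangle with a vertical side on the circle that
    crosses row v, with some of its O's discarded, so everything can be expressed
    by rectangles.

    Write the differential of G+ as N + L + R, where L (resp. R) counts the
    rectangles that contain the square of row v to the right (resp. left) of the
    circle but not the other one.  Rescaling the states by monomials in V_u and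
    V_l, where O_u and O_l are the O's of the left and right column of G+, the
    differential of G- becomes N + aL + R/a with a = V_u/V_l, and the two maps
    become C- = aL + R and C+ = L + R/a.  The square of the differential with
    arbitrary weights on the squares is the sum of the weights of all thin annuli;
    comparing degrees in two extra weights gives LL = RR = 0, NL + LN = V_l and
    NR + RN = V_u.  These four relations imply that C- and C+ are chain maps and
    that both composites are LR + RL; this is homotopic to V_l through L and to
    V_u through R on G+, and through R/a and aL on G-. *)

Set Implicit Arguments.
Unset Strict Implicit.
Unset Printing Implicit Defensive.

Import GRing.Theory Num.Theory.
Local Open Scope ring_scope.

Local Arguments in_interior : simpl never.

(** * Circular intervals *)

Section CircularDistance.
Variable n : nat.
Implicit Types c i j k : 'I_n.

Definition arc i j c : bool := (cdist i c < cdist i j)%N.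
Definition between i k j : bool := (0 < cdist i k < cdist i j)%N.

Lemma cdistE i j : cdist i j = (if i <= j then j - i else j + n - i)%N.
Proof.
rewrite /cdist; have := ltn_ord i; have := ltn_ord j.
case: (leqP i j) => ij ? ?; last by rewrite modn_small //; lia.
by rewrite -addnBAC // modnDr modn_small //; lia.
Qed.

Lemma ord_eqE i j : (i == j) = (nat_of_ord i == nat_of_ord j).
Proof. by []. Qed.

End CircularDistance.

Ltac arc_lia :=
  rewrite /arc /between ?cdistE ?ord_eqE;
  repeat match goal with c : ordinal _ |- _ =>
    let k := fresh in have := ltn_ord c; move: (nat_of_ord c) => k; clear c end;
  repeat case: ifP; lia.

Section Arcs.
Variable n : nat.
Implicit Types a b c d i j k l p q r : 'I_n.

Lemma arc_left i j : i != j -> arc i j i.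
Proof. arc_lia. Qed.

Lemma arc_right i j : arc i j j = false.
Proof. arc_lia. Qed.

Lemma between_arc i j c : between i c j = (c != i) && arc i j c.
Proof. arc_lia. Qed.

Lemma arcC i j c : i != j -> arc j i c = ~~ arc i j c.
Proof. arc_lia. Qed.

Lemma between_rot p q r : between p q r -> between q r p.
Proof. arc_lia. Qed.

Lemma betweenC p q r : p != q -> q != r -> r != p -> between p r q = ~~ between p q r.
Proof. arc_lia. Qed.

Lemma arc_split p q r c : between p q r -> arc p r c = arc p q c || arc q r c.
Proof. arc_lia. Qed.

Lemma arc_disj p q r c : between p q r -> arc p q c -> arc q r c = false.
Proof. arc_lia. Qed.

(** Two pairs of points on a circle either do not separate each other or interleave; in the second
    case one bit determines all four relations. *)
Lemma between_four i j k l :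
  i != j -> k != l -> i != k -> i != l -> j != k -> j != l ->
  (between i k j == between i l j) && (between k i l == between k j l) ||
  [&& between k j l == between i k j, between i l j == ~~ between i k j
    & between k i l == ~~ between i k j].
Proof. arc_lia. Qed.

(** Between neighbouring columns, membership in a half-open arc changes only at its ends: it starts
    at [p] and stops at [q]. *)
Lemma arc_next i j p q : nat_of_ord j = i.+1 -> p != q ->
  (arc p q j + (q == j) = arc p q i + (p == j))%N.
Proof. arc_lia. Qed.

(** The arcs from [p] to [q] and from [q] to [w] concatenate to the arc from [p] to [w], plus a full
    turn exactly when [w] lies in the first arc. *)
Lemma arc_shift p q r w : p != q -> (arc p q w + arc p w r = arc p q r + arc q w r)%N.
Proof. arc_lia. Qed.

(** Cutting the circle at 0 gives linear comparisons; [q < p] corrects for an arc that wraps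
    around. *)
Lemma arc_add_lt p q r : r != q -> (arc p q r + (r < p) = (q < p) + (r < q))%N.
Proof. arc_lia. Qed.

Lemma ordSE i : nat_of_ord (ordS i) = (if i.+1 == n then 0 else i.+1)%N.
Proof.
rewrite /=; case: eqP => [->|]; first by rewrite modnn.
by have := ltn_ord i => ? ?; rewrite modn_small //; lia.
Qed.

Lemma arc_ordSP i j : j != i -> reflect (forall c, arc i j c -> c = i) (j == ordS i).
Proof.
move=> ji; apply: (iffP idP).
  move=> jS c; apply: contraTeq => ci; move: jS ci ji.
  by rewrite !ord_eqE ordSE; case: (i.+1 =P n); arc_lia.
move=> h; apply/contraT => jS; have: arc i j (ordS i).
  by move: jS ji; clear h; rewrite /arc !cdistE !ord_eqE ordSE; case: (i.+1 =P n); arc_lia.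
move/h/eqP; move: jS ji; rewrite !ord_eqE ordSE.
by clear h; have := ltn_ord j; case: (i.+1 =P n); lia.
Qed.
End Arcs.

(** * The square of the differential with weighted squares *)

Section Corners.
Variable n : nat.
Implicit Types (x y z : 'S_n) (i j k l p q r a b c d : 'I_n).

Definition corners x i j : rect n := ((i, x i), (j, x j)).
Definition swapped x i j : 'S_n := (tperm i j * x)%g.

Lemma swappedl x i j : swapped x i j i = x j.
Proof. by rewrite permM tpermL. Qed.

Lemma swappedr x i j : swapped x i j j = x i.
Proof. by rewrite permM tpermR. Qed.

Lemma swappedD x i j k : k != i -> k != j -> swapped x i j k = x k.
Proof. by move=> ki kj; rewrite permM tpermD // eq_sym. Qed.

Lemma swappedC x i j : swapped x i j = swapped x j i.
Proof. by rewrite /swapped tpermC. Qed.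

Lemma swappedK x i j : swapped (swapped x i j) i j = x.
Proof. by rewrite /swapped mulgA tperm2 mul1g. Qed.

Definition is_empty x i j : bool :=
  [forall k, ~~ in_interior (corners x i j) k (x k)].

Lemma in_interiorE i a j b c r :
  in_interior ((i, a), (j, b)) c r = between i c j && between a r b.
Proof. by []. Qed.

(** The columns of the SW and NE corners determine the rectangle and its target. Testing emptiness
    on [x] suffices, since [y] differs from [x] only at corners, which are never interior. *)
Lemma in_empty_rects x y (Q : rect n) :
  (Q \in empty_rects x y) =
  [&& Q.1.1 != Q.2.1, is_empty x Q.1.1 Q.2.1,
      y == swapped x Q.1.1 Q.2.1 & Q == corners x Q.1.1 Q.2.1].
Proof.
case: Q => [[i a] [j b]]; rewrite inE /= /corners.
have [->|ij] := eqVneq i j; first by [].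
rewrite /connects /=; apply/idP/idP.
  case/andP=> /and5P[/eqP xa /eqP xb /eqP yb /eqP ya /forallP h] /forallP e.
  have ey : y = swapped x i j.
    apply/permP => k; have [->|ki] := eqVneq k i; first by rewrite swappedl yb xb.
    have [->|kj] := eqVneq k j; first by rewrite swappedr ya xa.
    by rewrite swappedD //; have := h k; rewrite ki kj => /eqP->.
  rewrite ey eqxx xa xb eqxx !andbT.
  by apply/forallP => k; rewrite /corners xa xb; case/andP: (e k).
case/and3P=> /forallP e /eqP-> /eqP[-> ->].
rewrite !eqxx swappedl swappedr !eqxx /=; apply/andP; split.
  apply/forallP => k; apply/implyP => /andP[ki kj].
  by rewrite swappedD.
apply/forallP => k; rewrite (e k) /= !in_interiorE.
have [->|ki] := eqVneq k i; first by rewrite between_arc eqxx.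
have [->|kj] := eqVneq k j; first by rewrite between_arc arc_right andbF.
by rewrite swappedD //; apply: e.
Qed.

Lemma sum_empty_rects (V : nmodType) x (F : 'S_n -> rect n -> V) :
  \sum_y \sum_(Q in empty_rects x y) F y Q =
  \sum_i \sum_(j | (j != i) && is_empty x i j) F (swapped x i j) (corners x i j).
Proof.
rewrite pair_big_dep pair_big_dep /=.
rewrite (reindex_onto (fun e : 'I_n * 'I_n => (swapped x e.1 e.2, corners x e.1 e.2))
  (fun e : 'S_n * rect n => (e.2.1.1, e.2.2.1))) /=; last first.
  by case=> y Q /=; rewrite in_empty_rects => /and4P[_ _ /eqP<- /eqP<-].
apply: eq_bigl => -[i j] /=; rewrite in_empty_rects /= !eqxx !andbT.
by rewrite eq_sym.
Qed.

End Corners.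

(** * Domains of two successive rectangles and their cancellation in characteristic two *)

Section SquareZero.
Variables (n : nat) (R : comNzRingType) (W : 'I_n -> 'I_n -> R).
Hypothesis addxx : forall w : R, w + w = 0.
Implicit Types (x y z : 'S_n) (i j k l p q r a b c d : 'I_n).

Definition square_weight (Q : rect n) : R :=
  \prod_c \prod_r W c r ^+ square_in Q c r.

Definition rect_matrix x y : R := \sum_(Q in empty_rects x y) square_weight Q.

(* Emptiness is absorbed into the weights: a rectangle with corners in the
   columns of H contains no other point of x iff it contains none of the
   squares that have such a point as SW corner, so these squares get weight 0. *)
Definition block (H : {set 'I_n}) x i j a b : R :=
  \prod_(c | arc i j c) \prod_(r | arc a b r)
     if (r == x c) && (c \notin H) then 0 else W c r.

Lemma block_eq0 (H : {set 'I_n}) x i j a b k :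
  k \notin H -> arc i j k -> arc a b (x k) -> block H x i j a b = 0.
Proof.
move=> kH ik ak; rewrite /block (bigD1 k) //= (bigD1 (x k)) //= eqxx kH.
by rewrite !mul0r.
Qed.

Lemma eq_block (H : {set 'I_n}) x y i j a b :
  (forall k, k \notin H -> x k = y k) -> block H x i j a b = block H y i j a b.
Proof.
move=> xy; apply: eq_bigr => c _; apply: eq_bigr => r _.
by case cH: (c \notin H); rewrite ?andbF // xy.
Qed.

Lemma block_splitl (H : {set 'I_n}) x p q r a b : between p q r ->
  block H x p r a b = block H x p q a b * block H x q r a b.
Proof.
move=> pqr; rewrite /block (bigID (arc p q)) /=; congr (_ * _); apply: eq_bigl => c.
  by rewrite (arc_split _ pqr) andb_orl andbb andbC orb_idr // => /andP[].
rewrite (arc_split _ pqr); case pq: (arc p q c) => /=; last by rewrite andbT.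
by rewrite (arc_disj pqr pq).
Qed.

Lemma block_splitr (H : {set 'I_n}) x i j a b c : between a b c ->
  block H x i j a c = block H x i j a b * block H x i j b c.
Proof.
move=> abc; rewrite /block -big_split; apply: eq_bigr => k _ /=.
rewrite (bigID (arc a b)) /=; congr (_ * _); apply: eq_bigl => r.
  by rewrite (arc_split _ abc) andb_orl andbb andbC orb_idr // => /andP[].
rewrite (arc_split _ abc); case pq: (arc a b r) => /=; last by rewrite andbT.
by rewrite (arc_disj abc pq).
Qed.

Lemma square_weightE i a j b :
  square_weight ((i, a), (j, b)) = \prod_(c | arc i j c) \prod_(r | arc a b r) W c r.
Proof.
rewrite /square_weight [RHS]big_mkcond; apply: eq_bigr => c _ /=.
rewrite -/(arc i j c); case: (arc i j c) => /=; last by rewrite big1.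
by rewrite [RHS]big_mkcond; apply: eq_bigr => r _; rewrite -/(arc a b r); case: arc.
Qed.

(** Lets rectangles with different corner columns be written over one common set of exempt columns
    and so be cut into the same blocks. *)
Lemma block_widen (H H' : {set 'I_n}) x i j a b : H \subset H' ->
  (forall k, k \in H' -> k \notin H -> ~~ (arc i j k && arc a b (x k))) ->
  block H x i j a b = block H' x i j a b.
Proof.
move=> /subsetP sH h; apply: eq_bigr => c ic; apply: eq_bigr => r ar.
case: eqP => //= e; case cH: (c \in H); first by rewrite sH.
case cH': (c \in H') => //=.
by have := h c cH' (negbT cH); rewrite ic -e ar.
Qed.

(** Only the corner in column [i] can lie on the left or bottom side, so any other point of [x] that
    is the SW corner of a square of the rectangle is interior. *)
Lemma empty_blockE x i j : j != i ->
  (if is_empty x i j then square_weight (corners x i j) else 0) =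
  block [set i; j] x i j (x i) (x j).
Proof.
move=> ji; rewrite square_weightE; case: ifP => [/forallP e|].
  rewrite /block; apply: eq_bigr => c ic; apply: eq_bigr => r ar.
  case: ifP => // /andP[/eqP er]; rewrite !inE negb_or => /andP[ci cj].
  move: (e c); rewrite in_interiorE !between_arc ci ic -er ar er.
  by rewrite (inj_eq perm_inj) ci.
move=> /negbT /forallPn[k]; rewrite negbK in_interiorE !between_arc.
case/andP=> /andP[ki ik] /andP[_ ak]; rewrite (@block_eq0 _ _ _ _ _ _ k) //.
rewrite !inE negb_or ki /=; apply: contraTneq ik => ->.
by rewrite arc_right.
Qed.

Lemma sum_rect_matrix x (F : 'S_n -> R) :
  \sum_y rect_matrix x y * F y =
  \sum_i \sum_(j | j != i) block [set i; j] x i j (x i) (x j) * F (swapped x i j).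
Proof.
under eq_bigr do rewrite /rect_matrix mulr_suml.
rewrite (sum_empty_rects x (fun y Q => square_weight Q * F y)).
apply: eq_bigr => i _; rewrite big_mkcondr; apply: eq_bigr => j ji.
by rewrite -empty_blockE //; case: ifP; rewrite ?mul0r.
Qed.

Lemma rect_matrixE x z :
  rect_matrix x z = \sum_i \sum_(j | j != i)
    block [set i; j] x i j (x i) (x j) * (swapped x i j == z)%:R.
Proof.
rewrite -(sum_rect_matrix x (fun y => (y == z)%:R)) (bigD1 z) //= eqxx mulr1
  big1 ?addr0 // => y yz.
by rewrite (negbTE yz) mulr0.
Qed.

Definition rect_block x i j : R := block [set i; j] x i j (x i) (x j).

Lemma rect_block3 (H : {set 'I_n}) x i j k :
  (forall m, (m \in H) = [|| m == i, m == j | m == k]) -> k != i -> k != j ->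
  rect_block x i j =
  if between i k j && between (x i) (x k) (x j) then 0
  else block H x i j (x i) (x j).
Proof.
move=> HE ki kj; rewrite !between_arc (inj_eq perm_inj) ki /=.
have kN : k \notin [set i; j] by rewrite !inE negb_or ki.
case: ifP => [/andP[ik ak]|nE]; first exact: block_eq0 ak.
apply: block_widen => [|m]; first by apply/subsetP => m; rewrite !inE HE orbA => ->.
by rewrite HE !inE orbA => /orP[-> //|/eqP-> _]; rewrite nE.
Qed.

Lemma between_rotE p q r : between q r p = between p q r.
Proof. by apply/idP/idP => [/between_rot/between_rot|/between_rot]. Qed.

(* The two-step domains that move the points of columns p, q and r cyclically and
   share a corner in column q. *)
Definition hook x p q r : R :=
  (rect_block x p q + rect_block x q p) *
  (rect_block (swapped x p q) q r + rect_block (swapped x p q) r q).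

(* The three points cut the torus into nine blocks, and each of the domains
   involved is cut into two rectangles in exactly two ways. *)
Lemma hook_cancel x p q r : p != q -> q != r -> r != p ->
  hook x p q r + hook x q r p + hook x r p q = 0.
Proof.
move=> pq qr rp; rewrite /hook.
have qp : q != p by rewrite eq_sym.
have rq : r != q by rewrite eq_sym.
have pr : p != r by rewrite eq_sym.
pose H := [set p; q; r].
(* Expresses every rectangle through blocks of the one state [x]: all states involved agree with [x]
   off the columns [p], [q], [r]. *)
have E y i j k : (forall m, m \notin H -> y m = x m) ->
  (forall m, (m \in H) = [|| m == i, m == j | m == k]) -> k != i -> k != j ->
  rect_block y i j = if between i k j && between (y i) (y k) (y j) then 0
  else block H x i j (y i) (y j).
  move=> yx Hijk ki kj; rewrite (rect_block3 y Hijk ki kj); case: ifP => // _.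
  exact: eq_block.
have Hx m : m \notin H -> x m = x m by [].
have Hs i j m : i \in H -> j \in H -> m \notin H -> swapped x i j m = x m.
  by move=> iH jH mH; rewrite swappedD //; apply: contraNneq mH => ->.
have HH : [&& p \in H, q \in H & r \in H] by rewrite !inE !eqxx !orbT.
case/and3P: HH => pH qH rH.
have Hpq m := @Hs p q m pH qH; have Hqr m := @Hs q r m qH rH.
have Hrp m := @Hs r p m rH pH.
have Mpqr m : (m \in H) = [|| m == p, m == q | m == r] by rewrite !inE orbA.
have Mqpr m : (m \in H) = [|| m == q, m == p | m == r] by rewrite Mpqr orbCA.
have Mqrp m : (m \in H) = [|| m == q, m == r | m == p].
  by rewrite Mqpr [(m == p) || _]orbC.
have Mrqp m : (m \in H) = [|| m == r, m == q | m == p] by rewrite Mqrp orbCA.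
have Mprq m : (m \in H) = [|| m == p, m == r | m == q].
  by rewrite Mpqr [(m == q) || _]orbC.
have Mrpq m : (m \in H) = [|| m == r, m == p | m == q] by rewrite Mprq orbCA.
rewrite (E x p q r Hx Mpqr rp rq) (E x q p r Hx Mqpr rq rp).
rewrite (E x q r p Hx Mqrp pq pr) (E x r q p Hx Mrqp pr pq).
rewrite (E x r p q Hx Mrpq qr qp) (E x p r q Hx Mprq qp qr).
rewrite (E _ q r p Hpq Mqrp pq pr) (E _ r q p Hpq Mrqp pr pq).
rewrite (E _ r p q Hqr Mrpq qr qp) (E _ p r q Hqr Mprq qp qr).
rewrite (E _ p q r Hrp Mpqr rp rq) (E _ q p r Hrp Mqpr rq rp).
rewrite !swappedl !swappedr !swappedD //.
have xI i j : i != j -> x i != x j by rewrite (inj_eq perm_inj).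
have := xI _ _ pq; have := xI _ _ qr; have := xI _ _ rp.
move: (x p) (x q) (x r) => a b c ca bc ab.
rewrite (betweenC pq qr rp) (betweenC qr rp pq) (betweenC rp pq qr).
rewrite (betweenC ab bc ca) (betweenC bc ca ab) (betweenC ca ab bc).
rewrite (between_rotE q r p) (between_rotE p q r).
rewrite (between_rotE b c a) (between_rotE a b c).
have := betweenC pq qr rp; have := betweenC ab bc ca.
have twice (s t : R) : s = t + t -> s = 0 by move=> ->; apply: addxx.
pose B := block H x.
(* Cases by the cyclic orders of the columns and of the rows. In each, six of the twelve products
   survive. The witness for [twice] lists three of them; cutting all blocks at the third column and
   row shows that the other three have the same sum. *)
case pqr: (between p q r); case abc: (between a b c) => /= h h'.
- apply: (twice _ (B p q a b * (B q r a c + B r q c a) + B q r b c * B r p b a)).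
  rewrite /B !(block_splitl _ _ _ _ pqr, block_splitl _ _ _ _ (between_rot pqr),
    block_splitl _ _ _ _ (between_rot (between_rot pqr))).
  rewrite !(block_splitr _ _ _ _ abc, block_splitr _ _ _ _ (between_rot abc),
    block_splitr _ _ _ _ (between_rot (between_rot abc))).
  ring.
- apply: (twice _ ((B p q a b + B q p b a) * B q r a c + B r q c b * B r p b a)).
  rewrite /B !(block_splitl _ _ _ _ pqr, block_splitl _ _ _ _ (between_rot pqr),
    block_splitl _ _ _ _ (between_rot (between_rot pqr))).
  rewrite !(block_splitr _ _ _ _ h, block_splitr _ _ _ _ (between_rot h),
    block_splitr _ _ _ _ (between_rot (between_rot h))).
  ring.
- apply: (twice _ ((B p q a b + B q p b a) * B r q c a + B q r b c * B p r a b)).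
  rewrite /B !(block_splitl _ _ _ _ h', block_splitl _ _ _ _ (between_rot h'),
    block_splitl _ _ _ _ (between_rot (between_rot h'))).
  rewrite !(block_splitr _ _ _ _ abc, block_splitr _ _ _ _ (between_rot abc),
    block_splitr _ _ _ _ (between_rot (between_rot abc))).
  ring.
- apply: (twice _ (B q p b a * (B q r a c + B r q c a) + B r q c b * B p r a b)).
  rewrite /B !(block_splitl _ _ _ _ h', block_splitl _ _ _ _ (between_rot h'),
    block_splitl _ _ _ _ (between_rot (between_rot h'))).
  rewrite !(block_splitr _ _ _ _ h, block_splitr _ _ _ _ (between_rot h),
    block_splitr _ _ _ _ (between_rot (between_rot h))).
  ring.
Qed.

(** Exchanging the rows of one pair affects the emptiness of the other rectangle only if both the
    columns and the rows of the two pairs interleave; in that case both products vanish. *)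
Lemma disjoint_rect_blocks x i j k l :
  i != j -> k != l -> i != k -> i != l -> j != k -> j != l ->
  rect_block x i j * rect_block (swapped x i j) k l =
  rect_block x k l * rect_block (swapped x k l) i j.
Proof.
move=> ij kl ik il jk jl; pose H := [set i; j; k; l].
have E y p q m m' : [set p; q; m; m'] = H -> (forall c, c \notin H -> y c = x c) ->
    m \notin [set p; q] -> m' \notin [set p; q] ->
    rect_block y p q = if between p m q && between (y p) (y m) (y q)
      || between p m' q && between (y p) (y m') (y q)
    then 0 else block H x p q (y p) (y q).
  move=> HE yx mN mN'; rewrite -(eq_block p q (y p) (y q) yx) -HE.
  have [mp mp'] : m != p /\ m' != p.
    by move: mN mN'; rewrite !inE !negb_or => /andP[-> _] /andP[-> _].
  rewrite !between_arc !(inj_eq perm_inj) mp mp' /=.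
  case: ifP => [/orP[]/andP[]|nE].
  - exact: block_eq0.
  - exact: block_eq0.
  apply: block_widen => [|c]; first by apply/subsetP => c; rewrite !inE => ->.
  move/negbT: nE; rewrite negb_or => /andP[nE nE'].
  by rewrite !inE => /orP[/orP[->//|/eqP->]|/eqP->].
have N a b c : a != b -> a != c -> a \notin [set b; c].
  by rewrite !inE negb_or => -> ->.
have [ki li kj lj] : [/\ k != i, l != i, k != j & l != j].
  by rewrite ![_ == i]eq_sym ![_ == j]eq_sym.
have HE : [set k; l; i; j] = H.
  by apply/setP => c; rewrite !inE; do 4 case: (c == _).
have S a b c : a \in H -> b \in H -> c \notin H -> swapped x a b c = x c.
  by move=> aH bH cH; rewrite swappedD //; apply: contraNneq cH => ->.
have [iH jH kH lH] : [/\ i \in H, j \in H, k \in H & l \in H].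
  by rewrite !inE !eqxx !orbT.
rewrite (E x i j k l) ?N // (E x k l i j) ?N //.
rewrite (E (swapped x i j) k l i j) ?N //; last by move=> c; apply: S.
rewrite (E (swapped x k l) i j k l) ?N //; last by move=> c; apply: S.
rewrite !swappedl !swappedr !swappedD //.
have xI p q : p != q -> x p != x q by rewrite (inj_eq perm_inj).
have := between_four (xI _ _ ij) (xI _ _ kl) (xI _ _ ik)
  (xI _ _ il) (xI _ _ jk) (xI _ _ jl).
have := between_four ij kl ik il jk jl.
move: (between i k j) (between i l j) (between k i l) (between k j l).
move: (between (x i) (x k) (x j)) (between (x i) (x l) (x j)).
move: (between (x k) (x i) (x l)) (between (x k) (x j) (x l)).
do 8 case; rewrite ?mul0r ?mulr0 // => _ _; exact: mulrC.
Qed.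

Lemma block_rows (H : {set 'I_n}) x i j a b : a != b ->
  block H x i j a b * block H x i j b a =
  \prod_(c | arc i j c) \prod_r if (r == x c) && (c \notin H) then 0 else W c r.
Proof.
move=> ab; rewrite /block -big_split; apply: eq_bigr => c _ /=.
rewrite [RHS](bigID (arc a b)); congr (_ * _); apply: eq_bigl => r.
exact: arcC.
Qed.

Lemma block_columns (H : {set 'I_n}) x i j a b : i != j ->
  block H x i j a b * block H x j i a b =
  \prod_c \prod_(r | arc a b r) if (r == x c) && (c \notin H) then 0 else W c r.
Proof.
move=> ij; rewrite /block [RHS](bigID (arc i j)); congr (_ * _).
by apply: eq_bigl => c; apply: arcC.
Qed.

Lemma nextP i j : j != i ->
  if j == ordS i then forall c, arc i j c -> c = i
  else exists2 c, arc i j c & c != i.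
Proof.
move=> ji; case: (arc_ordSP ji) => // nh.
have [/exists_inP[c ic ci]|/exists_inPn h] := boolP [exists c in arc i j, c != i].
  by exists c.
by case: nh => c /h; rewrite negbK => /eqP.
Qed.

Lemma swapped_off x i j c : c \notin [set i; j] -> swapped x i j c = x c.
Proof. by rewrite !inE negb_or => /andP[ci cj]; rewrite swappedD. Qed.

(** The second step returns to [x], and the two rectangles fill the vertical annulus from [i] to
    [j]; if this is wider than one column, it contains a point of [x] in a further column. *)
Lemma column_annulus x i j : j != i ->
  rect_block x i j * rect_block (swapped x i j) i j =
  if j == ordS i then \prod_r W i r else 0.
Proof.
move=> ji; rewrite /rect_block swappedl swappedr.
rewrite (eq_block i j (x j) (x i) (@swapped_off x i j)) block_rows; last first.
  by rewrite (inj_eq perm_inj) eq_sym.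
have := nextP ji; case: ifP => _ => [h|[c ic ci]].
  rewrite (big_pred1 i) => [|c].
    by apply: eq_bigr => r _; rewrite !inE eqxx andbF.
  by apply/idP/eqP => [/h //|->]; apply: arc_left; rewrite eq_sym.
rewrite (bigD1 c ic) (bigD1 (x c)) //= eqxx.
rewrite !inE negb_or ci; case: eqP ic => [->|_ _] /=; first by rewrite arc_right.
by rewrite !mul0r.
Qed.

Lemma row_annulus x i j : j != i ->
  rect_block x i j * rect_block (swapped x i j) j i =
  if x j == ordS (x i) then \prod_c W c (x i) else 0.
Proof.
move=> ji; rewrite /rect_block swappedl swappedr [ [set j; i] ]setUC.
rewrite (eq_block j i (x i) (x j) (@swapped_off x i j)) block_columns; last first.
  by rewrite eq_sym.
have xji : x j != x i by rewrite (inj_eq perm_inj).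
have := nextP xji; case: ifP => _ => [h|[r ar ra]].
  apply: eq_bigr => c _; rewrite (big_pred1 (x i)) => [|r].
    by case: ifP => //; rewrite (inj_eq perm_inj) !inE => /andP[/eqP<-]; rewrite eqxx.
  by apply/idP/eqP => [/h //|->]; apply: arc_left; rewrite eq_sym.
rewrite (bigD1 ((x^-1)%g r)) //= (bigD1 r) //=.
rewrite permKV eqxx /= !inE negb_or.
have -> : (x^-1)%g r != i by apply: contraNneq ra => <-; rewrite permKV.
suff -> : (x^-1)%g r != j by rewrite /= !mul0r.
by apply: contraTneq ar => <-; rewrite permKV arc_right.
Qed.

Lemma swapped_rot x p q r : p != q -> q != r -> r != p ->
  swapped (swapped x p q) q r = swapped (swapped x q r) r p.
Proof.
move=> pq qr rp; have [qp rq pr] : [/\ q != p, r != q & p != r].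
  by rewrite [q == p]eq_sym [r == q]eq_sym [p == r]eq_sym.
apply/permP => m; have [->|mp] := eqVneq m p.
  by rewrite swappedr swappedr swappedD // swappedl.
have [->|mq] := eqVneq m q; first by rewrite swappedl [RHS]swappedD // swappedl swappedD.
have [->|mr] := eqVneq m r; first by rewrite swappedr swappedl swappedr swappedD.
by rewrite !swappedD.
Qed.

Lemma sum_symmetric (I : finType) (F : I -> I -> R) :
  (forall e f, F e f = F f e) -> (forall e, F e e = 0) -> \sum_e \sum_f F e f = 0.
Proof.
move=> FC F0.
pose lt (e f : I) := (enum_rank e < enum_rank f)%N.
have -> : \sum_e \sum_f F e f =
    \sum_e \sum_(f | lt e f) F e f + \sum_e \sum_(f | lt f e) F e f.
  rewrite -big_split; apply: eq_bigr => e _; rewrite (bigD1 e) //= F0 add0r.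
  rewrite (bigID (lt e)) /=; congr (_ + _); apply: eq_bigl => f.
    by rewrite /lt; case: eqP => [->|] /=; rewrite ?ltnn.
  rewrite /lt -leqNgt [RHS]ltn_neqAle; congr (_ && _).
  by rewrite (inj_eq val_inj) (inj_eq enum_rank_inj).
rewrite [X in _ + X](exchange_big_dep xpredT) //=
  -[RHS](addxx (\sum_e \sum_(f | lt e f) F e f)).
congr (_ + _); apply: eq_bigr => e _; exact: eq_bigr.
Qed.

(** * The sum over two steps, sorted by the number of columns that the steps share *)

Section TwoSteps.
Variables x z : 'S_n.

Let two_steps i j k l : R :=
  rect_block x i j * rect_block (swapped x i j) k l *
  (swapped (swapped x i j) k l == z)%:R.

Let disjoint_steps i j k l : R :=
  if [&& i != j, k != l, i != k, i != l, j != k & j != l] then two_steps i j k l else 0.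

Let distinct p q r := [&& p != q, q != r & r != p].

(** The second pair of columns equals the first, shares exactly one column with it ([i] in the first
    sum over [r], [j] in the second), or is disjoint from it. *)
Lemma two_steps_split i j : j != i ->
  \sum_k \sum_(l | l != k) two_steps i j k l =
  two_steps i j i j + two_steps i j j i
  + \sum_r (if distinct i j r then two_steps i j i r + two_steps i j r i else 0)
  + \sum_r (if distinct i j r then two_steps i j j r + two_steps i j r j else 0)
  + \sum_k \sum_l disjoint_steps i j k l.
Proof.
move=> ji; have ij : i != j by rewrite eq_sym.
have D (F : 'I_n -> R) p q : q != p ->
    \sum_(l | l != p) F l = F q + \sum_(l | (l != p) && (l != q)) F l.
  by move=> qp; rewrite (bigD1 q).
rewrite (bigD1 i) //= (D _ i j ji) (D (fun k => \sum_(l | l != k) _ k l) i j ji) /=.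
rewrite (D (two_steps i j j) j i ij).
have -> : \sum_(k | (k != i) && (k != j)) \sum_(l | l != k) two_steps i j k l =
   \sum_(r | (r != i) && (r != j)) two_steps i j r i +
   \sum_(r | (r != i) && (r != j)) two_steps i j r j +
   \sum_k \sum_l disjoint_steps i j k l.
  rewrite -!big_split [X in _ + X](bigID (fun k => (k != i) && (k != j))) /=.
  rewrite [X in _ + (_ + X)]big1 ?addr0 => [|k]; last first.
    rewrite negb_and !negbK => kij; rewrite big1 // => l _; rewrite /disjoint_steps.
    by case/orP: kij => /eqP->; rewrite eqxx ?andbF.
  rewrite -big_split; apply: eq_bigr => k /andP[ki kj] /=.
  have [ik jk] : i != k /\ j != k by rewrite eq_sym ki eq_sym kj.
  rewrite (bigD1 i ik) /= (bigD1 j) ?jk ?ji //= -!addrA; congr (_ + (_ + _)).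
  rewrite big_mkcond; apply: eq_bigr => l _; rewrite /disjoint_steps ij ik jk /=.
  by rewrite ![_ == l]eq_sym andbA.
have E (F : 'I_n -> R) : \sum_r (if distinct i j r then F r else 0) =
    \sum_(r | (r != i) && (r != j)) F r.
  rewrite [RHS]big_mkcond; apply: eq_bigr => r _.
  by rewrite /distinct ij /= [j == r]eq_sym andbC.
rewrite !E !big_split /= [X in _ + (_ + X + _)](eq_bigl (fun r => (r != i) && (r != j))).
  ring.
by move=> r; rewrite andbC.
Qed.

Lemma sum_hooks :
  \sum_p \sum_q \sum_r (if distinct p q r then
    hook x p q r * (swapped (swapped x p q) q r == z)%:R else 0) = 0.
Proof.
pose f p q r : R := if distinct p q r then
  hook x p q r * (swapped (swapped x p q) q r == z)%:R else 0.
rewrite -/f; set S := LHS.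
have rot (g : 'I_n -> 'I_n -> 'I_n -> R) :
    \sum_p \sum_q \sum_r g q r p = \sum_p \sum_q \sum_r g p q r.
  by rewrite exchange_big; apply: eq_bigr => q _; rewrite exchange_big.
(* In characteristic two a sum equals three copies of itself; rotating the column names in two of
   them lets [hook_cancel] act term by term. *)
transitivity (S + \sum_p \sum_q \sum_r f q r p + \sum_p \sum_q \sum_r f r p q).
  by rewrite (rot (fun p q r => f q r p)) !(rot f) addxx add0r.
rewrite /S -!big_split big1 // => p _.
rewrite -!big_split big1 // => q _; rewrite -!big_split big1 // => r _ /=.
rewrite /f /distinct; have [pq|] := boolP (p != q); last first.
  by rewrite !andbF /= => _; rewrite !addr0.
have [qr|] := boolP (q != r); last by rewrite !andbF /= => _; rewrite !addr0.
have [rp|] := boolP (r != p); last by rewrite !andbF /= => _; rewrite !addr0.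
rewrite /= (swapped_rot x rp pq qr) (swapped_rot x pq qr rp).
by rewrite -!mulrDl hook_cancel ?mul0r.
Qed.

Lemma sum_disjoint_steps : \sum_i \sum_j \sum_k \sum_l disjoint_steps i j k l = 0.
Proof.
rewrite pair_big /=; under eq_bigr do rewrite pair_big /=.
apply: sum_symmetric => [[i j] [k l]|[i j]] /=; last first.
  by rewrite /disjoint_steps eqxx !andbF.
rewrite /disjoint_steps /two_steps [k == i]eq_sym [k == j]eq_sym [l == i]eq_sym [l == j]eq_sym.
have [ij|] := boolP (i != j); last by rewrite andbF.
have [kl|] := boolP (k != l); last by rewrite andbF.
have [ik|//] := boolP (i != k); have [jl|] := boolP (j != l); last by rewrite !andbF.
have [il|] := boolP (i != l); last by rewrite !andbF.
have [jk|] := boolP (j != k); last by rewrite !andbF.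
rewrite /= disjoint_rect_blocks //; congr (_ * (_ == _)%:R); apply/permP => m.
have [ki li kj lj] : [/\ k != i, l != i, k != j & l != j].
  by rewrite ![_ == i]eq_sym ![_ == j]eq_sym.
have [->|mi] := eqVneq m i; first by rewrite swappedD // !swappedl swappedD.
have [->|mj] := eqVneq m j; first by rewrite swappedD // !swappedr swappedD.
have [->|mk] := eqVneq m k.
  by rewrite swappedl swappedD // [RHS]swappedD ?swappedl // eq_sym.
have [->|ml] := eqVneq m l.
  by rewrite swappedr swappedD // [RHS]swappedD ?swappedr // eq_sym.
by rewrite !swappedD.
Qed.

(** Every vertical and every horizontal circle carries exactly one point of [x], so each thin
    annulus arises once, from the point on its left or bottom circle. *)
Lemma sum_annuli : (1 < n)%N ->
  \sum_i \sum_(j | j != i) (two_steps i j i j + two_steps i j j i) =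
  (x == z)%:R * (\sum_c \prod_r W c r + \sum_r \prod_c W c r).
Proof.
move=> n_gt1; have oS (i : 'I_n) : ordS i != i.
  by rewrite ord_eqE ordSE; case: (i.+1 =P n); have := ltn_ord i; lia.
have -> : \sum_r \prod_c W c r = \sum_i \prod_c W c (x i).
  by rewrite (reindex_inj (@perm_inj _ x)).
rewrite -big_split mulr_sumr; apply: eq_bigr => i _ /=.
rewrite /two_steps; under eq_bigr => j ji.
  rewrite swappedK (swappedC _ j) swappedK -mulrDl (column_annulus x ji).
  rewrite (row_annulus x ji) mulrC; over.
rewrite -mulr_sumr big_split /=; congr (_ * (_ + _)).
  rewrite -big_mkcondr (big_pred1 (ordS i)) // => j.
  by rewrite andbC /=; case: eqP => [->|] //=; rewrite oS.
rewrite -big_mkcondr (big_pred1 ((x^-1)%g (ordS (x i)))) // => j.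
rewrite andbC /= -(inj_eq (@perm_inj _ x) j (_ _)) permKV; case: eqP => //= e.
by have := oS (x i); rewrite -e (inj_eq perm_inj) => ->.
Qed.

(** Hooks and disjoint pairs cancel, which leaves the annuli. The weights are arbitrary so that
    marking variables can be inserted later. *)
Theorem rect_matrix_sqr : (1 < n)%N ->
  \sum_y rect_matrix x y * rect_matrix y z =
  (x == z)%:R * (\sum_c \prod_r W c r + \sum_r \prod_c W c r).
Proof.
move=> n_gt1; rewrite -sum_annuli // sum_rect_matrix.
transitivity (\sum_i \sum_(j | j != i) \sum_k \sum_(l | l != k) two_steps i j k l).
  apply: eq_bigr => i _; apply: eq_bigr => j _; rewrite rect_matrixE mulr_sumr.
  apply: eq_bigr => k _; rewrite mulr_sumr; apply: eq_bigr => l _; exact: mulrA.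
under eq_bigr => i _ do under eq_bigr => j ji do rewrite (two_steps_split ji).
have off (F : 'I_n -> 'I_n -> R) : (forall i, F i i = 0) ->
    \sum_i \sum_(j | j != i) F i j = \sum_i \sum_j F i j.
  by move=> F0; apply: eq_bigr => i _; rewrite [RHS](bigD1 i) //= F0 add0r.
under eq_bigr do rewrite 3!big_split; rewrite 3!big_split /=.
rewrite (off (fun i j => \sum_k \sum_l _)) => [|i]; last first.
  by rewrite big1 // => k _; rewrite big1 // => l _; rewrite /disjoint_steps eqxx.
rewrite sum_disjoint_steps addr0 -addrA -[RHS]addr0; congr (_ + _).
rewrite !off; try by move=> i; rewrite big1 // => r _; rewrite /distinct eqxx.
(* Renames the columns of the steps that share [i], so that the common column is [q] in both sums
   and they combine into hooks. *)
rewrite [X in X + _]exchange_big -big_split -[RHS]sum_hooks; apply: eq_bigr => p _.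
rewrite -big_split; apply: eq_bigr => q _; rewrite -big_split; apply: eq_bigr => r _ /=.
have -> : distinct q p r = distinct p q r.
  by rewrite /distinct [q == p]eq_sym [p == r]eq_sym [r == q]eq_sym [X in _ && X]andbC.
case: ifP => _; rewrite ?addr0 //.
rewrite /two_steps /hook (swappedC x q p) (swappedC _ r q); ring.
Qed.

End TwoSteps.
End SquareZero.

(** * Rectangles that separate two squares *)

Section Straddling.
Variables (n : nat) (R : comNzRingType) (W : 'I_n -> 'I_n -> R).
Variables (i j v : 'I_n).
Hypothesis addxx : forall w : R, w + w = 0.
Hypothesis ij : i != j.
Implicit Types (x y z : 'S_n) (c d r : 'I_n) (Q : rect n).

Definition hits_only c d r Q : bool := square_in Q c r && ~~ square_in Q d r.

Definition part_matrix (P : pred (rect n)) x y : R :=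
  \sum_(Q in empty_rects x y | P Q) square_weight W Q.

Definition balanced c d r Q : bool := square_in Q c r == square_in Q d r.

(* The exponents 0, 1, 3, 4 of the four kinds of rectangles have sums that
   separate the products that matter. *)
Let mark c r : nat := ((c == j) && (r == v)) + ((c == i) && (r == v)) * 3.

Let marked c r : {poly R} := (W c r)%:P * 'X^(mark c r).

Let degree Q : nat := (square_in Q j v + square_in Q i v * 3)%N.

Let coeff (m : nat) x y : R := part_matrix (fun Q => degree Q == m) x y.

Lemma sum_mark (F : 'I_n -> 'I_n -> nat) :
  (\sum_c \sum_r mark c r * F c r = F j v + F i v * 3)%N.
Proof.
have D k c : (\sum_r (((c == k) && (r == v)) * F c r) = (c == k) * F k v)%N.
  rewrite (bigD1 v) //= eqxx andbT big1 => [|r rv].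
    by rewrite addn0; case: eqP => [->|].
  by rewrite (negbTE rv) andbF.
have S k : (\sum_c (c == k) * F k v = F k v)%N.
  rewrite (bigD1 k) //= eqxx mul1n big1 ?addn0 // => c ck.
  by rewrite (negbTE ck).
under eq_bigr => c _ do (under eq_bigr do rewrite /mark mulnDl mulnAC;
  rewrite big_split -big_distrl !D).
by rewrite big_split S -big_distrl S.
Qed.

Lemma square_weight_marked Q :
  square_weight marked Q = (square_weight W Q)%:P * 'X^(degree Q).
Proof.
rewrite /degree -(sum_mark (fun c r => square_in Q c r)) expr_sum rmorph_prod.
rewrite -big_split; apply: eq_bigr => c _; rewrite expr_sum rmorph_prod.
rewrite -big_split; apply: eq_bigr => r _.
by rewrite exprM exprMn rmorphXn.
Qed.

Lemma rect_matrix_marked x y :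
  rect_matrix marked x y = (coeff 0%N x y)%:P + (coeff 1%N x y)%:P * 'X
    + (coeff 3%N x y)%:P * 'X^3 + (coeff 4%N x y)%:P * 'X^4.
Proof.
have D m : (coeff m x y)%:P * 'X^m =
    \sum_(Q in empty_rects x y | degree Q == m) square_weight marked Q.
  rewrite rmorph_sum mulr_suml; apply: eq_bigr => Q /andP[_ /eqP<-].
  by rewrite square_weight_marked.
rewrite -[(coeff 0%N x y)%:P]mulr1 -['X]expr1 -(expr0 'X) !D.
rewrite /rect_matrix !big_mkcondr -!big_split /=; apply: eq_bigr => Q _.
rewrite /degree; case: square_in; case: square_in => /=; by rewrite ?add0r ?addr0.
Qed.

Lemma marked_column c :
  \prod_r marked c r = (\prod_r W c r)%:P * 'X^((c == j) + (c == i) * 3).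
Proof.
rewrite big_split -rmorph_prod -expr_sum; congr (_ * 'X^_).
have := sum_mark (fun c' _ => c' == c); rewrite (bigD1 c) //=.
rewrite [X in (_ + X)%N = _]big1 => [|d dc].
  rewrite addn0 [j == c]eq_sym [i == c]eq_sym => <-; apply: eq_bigr => r _.
  by rewrite eqxx muln1.
by rewrite big1 // => r _; rewrite (negbTE dc) muln0.
Qed.

Lemma marked_row r :
  \prod_c marked c r = (\prod_c W c r)%:P * 'X^((r == v) * 4).
Proof.
rewrite big_split -rmorph_prod -expr_sum; congr (_ * 'X^_).
have := sum_mark (fun _ r' => r' == r); rewrite exchange_big.
rewrite (bigD1 r) //= [X in (_ + X)%N = _]big1 => [|d dc].
  rewrite addn0 [v == r]eq_sym -mulnS => <-; apply: eq_bigr => c _.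
  by rewrite eqxx muln1.
by rewrite big1 // => c _; rewrite (negbTE dc) muln0.
Qed.

Let L := part_matrix (hits_only j i v).
Let Rt := part_matrix (hits_only i j v).
Let N := part_matrix (balanced i j v).

Lemma coeff1 x y : coeff 1%N x y = L x y.
Proof.
apply: eq_bigl => Q; congr (_ && _); rewrite /degree /hits_only.
by case: square_in; case: square_in.
Qed.

Lemma coeff3 x y : coeff 3%N x y = Rt x y.
Proof.
apply: eq_bigl => Q; congr (_ && _); rewrite /degree /hits_only.
by case: square_in; case: square_in.
Qed.

Lemma coeff04 x y : coeff 0%N x y + coeff 4%N x y = N x y.
Proof.
rewrite /coeff /N /part_matrix !big_mkcondr -big_split; apply: eq_bigr => Q _ /=.
rewrite /degree /balanced.
by case: square_in; case: square_in => /=; rewrite ?addr0 ?add0r.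
Qed.

(** Compares coefficients in [rect_matrix_sqr] for the marked weights. Degrees 2 and 6 contain only
    [L] twice and [Rt] twice; degrees 1 and 5 together give the relation of [N] with [L], degrees 3
    and 7 that of [N] with [Rt]. On the right, column [j], column [i] and row [v] have degrees 1, 3
    and 4. *)
Lemma straddle_relations x z : (1 < n)%N ->
  [/\ \sum_y L x y * L y z = 0, \sum_y Rt x y * Rt y z = 0,
      \sum_y (N x y * L y z + L x y * N y z) = (x == z)%:R * \prod_r W j r
    & \sum_y (N x y * Rt y z + Rt x y * N y z) = (x == z)%:R * \prod_r W i r].
Proof.
move=> n_gt1.
have addpp (p : {poly R}) : p + p = 0.
  by apply/polyP => k; rewrite coefD addxx coef0.
have E : \sum_y rect_matrix marked x y * rect_matrix marked y z =
    (x == z)%:R * (\sum_c (\prod_r W c r)%:P * 'X^((c == j) + (c == i) * 3) +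
      \sum_r (\prod_c W c r)%:P * 'X^((r == v) * 4)).
  rewrite (rect_matrix_sqr marked addpp x z n_gt1); congr (_ * (_ + _)).
    by apply: eq_bigr => c _; apply: marked_column.
  by apply: eq_bigr => r _; apply: marked_row.
(* The index is shifted by one to skip degree 0, where all annuli that miss both marked squares
   land. *)
have colE (d : nat) : (\sum_c (\prod_r W c r)%:P * 'X^((c == j) + (c == i) * 3))`_d.+1 =
    (if d == 0%N then \prod_r W j r else 0) + (if d == 2%N then \prod_r W i r else 0).
  have [ij' ji'] : (i == j) = false /\ (j == i) = false.
    by rewrite [j == i]eq_sym (negbTE ij).
  rewrite coef_sum (bigD1 j) //= (bigD1 i ij) //= !eqxx ij' ji'.
  rewrite [X in _ + (_ + X)]big1 => [|c /andP[/negbTE-> /negbTE->]]; last first.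
    by rewrite mulr1 coefC.
  by rewrite !coefCM !coefXn addr0; case: d => [|[|[|]]] *; rewrite ?mulr1 ?mulr0.
have rowE (d : nat) : (\sum_r (\prod_c W c r)%:P * 'X^((r == v) * 4))`_d.+1 =
    (if d == 3%N then \prod_c W c v else 0).
  rewrite coef_sum (bigD1 v) //= eqxx.
  rewrite [X in _ + X]big1 => [|c /negbTE->]; last by rewrite mulr1 coefC.
  by rewrite !coefCM !coefXn addr0; case: d => [|[|[|[|]]]] *; rewrite ?mulr1 ?mulr0.
have lhs (d : nat) :
   (\sum_y rect_matrix marked x y * rect_matrix marked y z)`_d = \sum_y
   nth 0 [:: coeff 0%N x y * coeff 0%N y z;
     coeff 0%N x y * coeff 1%N y z + coeff 1%N x y * coeff 0%N y z;
     coeff 1%N x y * coeff 1%N y z;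
     coeff 0%N x y * coeff 3%N y z + coeff 3%N x y * coeff 0%N y z;
     coeff 0%N x y * coeff 4%N y z + coeff 4%N x y * coeff 0%N y z
     + coeff 1%N x y * coeff 3%N y z + coeff 3%N x y * coeff 1%N y z;
     coeff 1%N x y * coeff 4%N y z + coeff 4%N x y * coeff 1%N y z;
     coeff 3%N x y * coeff 3%N y z;
     coeff 3%N x y * coeff 4%N y z + coeff 4%N x y * coeff 3%N y z;
     coeff 4%N x y * coeff 4%N y z] d.
  rewrite coef_sum; apply: eq_bigr => y _; rewrite !rect_matrix_marked.
  set s := [:: _; _; _; _; _; _; _; _; _].
  transitivity ((\poly_(k < 9) s`_k)`_d).
    apply: (congr1 (fun p : {poly R} => p`_d));
    rewrite poly_def !big_ord_recl big_ord0 /s /= -!mul_polyC.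
    rewrite !rmorphD !rmorphM /=; ring.
  rewrite coef_poly; case: ltnP => // ?; by rewrite nth_default.
have C (d : nat) := congr1 (fun p : {poly R} => p`_d.+1) E.
have {C}C (d : nat) : \sum_y _ = _ := etrans (esym (lhs d.+1)) (C d).
have xz (p : {poly R}) (d : nat) : ((x == z)%:R * p)`_d = (x == z)%:R * p`_d.
  by case: eqP; rewrite ?mul1r // !mul0r coef0.
(* These are the degrees 1, 2, 3, 5, 6, 7. Degree 4 mixes several kinds of products, and only there
   does the row annulus appear. *)
have := (C 0%N, C 1%N, C 2%N, C 4%N, C 5%N, C 6%N).
rewrite !xz !coefD !colE !rowE /= !addr0 !add0r mulr0.
case=> [[[[[C1 C2] C3] C5] C6] C7].
split.
- by rewrite -[RHS]C2; apply: eq_bigr => y _; rewrite !coeff1.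
- by rewrite -[RHS]C6; apply: eq_bigr => y _; rewrite !coeff3.
- rewrite -[RHS]addr0 -C1 -[X in _ = _ + X]C5 -big_split; apply: eq_bigr => y _.
  by rewrite -!coeff1 -!coeff04 /=; ring.
- rewrite -[RHS]addr0 -C3 -[X in _ = _ + X]C7 -big_split; apply: eq_bigr => y _.
  by rewrite -!coeff3 -!coeff04 /=; ring.
Qed.

End Straddling.

(** * Consequences of the four relations over a field of characteristic two *)

Section CrossingAlgebra.
Variables (K : fieldType) (T : finType) (N L R : T -> T -> K) (a b : K) (phi : T -> K).
Hypothesis addxx : forall w : K, w + w = 0.
Hypotheses (a0 : a != 0) (b0 : b != 0) (phi0 : forall x, phi x != 0).
Hypothesis LL : forall x z, \sum_y L x y * L y z = 0.
Hypothesis RR : forall x z, \sum_y R x y * R y z = 0.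
Hypothesis NL : forall x z, \sum_y (N x y * L y z + L x y * N y z) = (x == z)%:R * b.
Hypothesis NR : forall x z, \sum_y (N x y * R y z + R x y * N y z) = (x == z)%:R * a.

(** Here [a] and [b] stand for $V_u$ and $V_l$, and [phi] for the rescaling of the states of G-. *)
Definition alg_dp x y := N x y + L x y + R x y.
Definition alg_dm x y := phi y / phi x * (N x y + a / b * L x y + b / a * R x y).
Definition alg_cm x y := phi y * (a / b * L x y + R x y).
Definition alg_cp x y := (phi x)^-1 * (L x y + b / a * R x y).

(** Reduces each identity below to finding coefficients: only the two anticommutators contribute,
    and the doubled terms [t] vanish. *)
Lemma sum_relations x z (F : T -> K) (c1 c2 c3 c4 : K) (t : T -> K) :
  (forall y, F y = c1 * (N x y * L y z + L x y * N y z)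
    + c2 * (N x y * R y z + R x y * N y z)
    + c3 * (L x y * L y z) + c4 * (R x y * R y z) + (t y + t y)) ->
  \sum_y F y = (x == z)%:R * (c1 * b + c2 * a).
Proof.
move=> FE; under eq_bigr do rewrite FE addxx addr0.
rewrite !big_split -!mulr_sumr NL NR LL RR /=; ring.
Qed.

Lemma eq_addxx (s t : K) : s + t = 0 -> s = t.
Proof. by move=> h; apply: (addIr t); rewrite h addxx. Qed.

Lemma alg_cm_chain x z : \sum_y alg_cm x y * alg_dm y z = \sum_y alg_dp x y * alg_cm y z.
Proof.
apply: eq_addxx; rewrite -big_split.
rewrite (@sum_relations x z _ (phi z * (a / b)) (phi z) (phi z * (a / b) * (a / b + 1))
  (phi z * (b / a + 1))
  (fun y => phi z * (L x y * R y z + a / b * (R x y * L y z)))).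
  (* The two anticommutators contribute [phi z * a] each, and these cancel. *)
  have -> : phi z * (a / b) * b + phi z * a = phi z * a + phi z * a by field.
  by rewrite addxx mulr0.
move=> y; rewrite /alg_cm /alg_dm /alg_dp /=; field.
by rewrite phi0 a0 b0.
Qed.

Lemma alg_cp_chain x z : \sum_y alg_cp x y * alg_dp y z = \sum_y alg_dm x y * alg_cp y z.
Proof.
apply: eq_addxx; rewrite -big_split.
rewrite (@sum_relations x z _ (phi x)^-1 ((phi x)^-1 * (b / a)) ((phi x)^-1 * (a / b + 1))
  ((phi x)^-1 * (b / a) * (b / a + 1))
  (fun y => (phi x)^-1 * (L x y * R y z + b / a * (R x y * L y z)))).
  have -> : (phi x)^-1 * b + (phi x)^-1 * (b / a) * a = (phi x)^-1 * b + (phi x)^-1 * b.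
    by field; rewrite a0 phi0.
  by rewrite addxx mulr0.
move=> y; rewrite /alg_cp /alg_dm /alg_dp /=; field.
by rewrite !phi0 a0 b0.
Qed.

(** The composite is LR + RL; the anticommutator of L with N + L + R doubles these mixed terms and
    leaves NL + LN. *)
Lemma alg_cm_cp_L x z :
  \sum_y alg_cm x y * alg_cp y z
  + \sum_y (alg_dp x y * L y z + L x y * alg_dp y z) = (x == z)%:R * b.
Proof.
rewrite -big_split (@sum_relations x z _ 1 0 (a / b) (b / a)
  (fun y => L x y * L y z + L x y * R y z + R x y * L y z)).
  by rewrite mul1r mul0r addr0.
move=> y; rewrite /alg_cm /alg_cp /alg_dp /=; field.
by rewrite !phi0 a0 b0.
Qed.

Lemma alg_cm_cp_R x z :
  \sum_y alg_cm x y * alg_cp y z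
  + \sum_y (alg_dp x y * R y z + R x y * alg_dp y z) = (x == z)%:R * a.
Proof.
rewrite -big_split (@sum_relations x z _ 0 1 (a / b) (b / a)
  (fun y => R x y * R y z + L x y * R y z + R x y * L y z)).
  by rewrite mul1r mul0r add0r.
move=> y; rewrite /alg_cm /alg_cp /alg_dp /=; field.
by rewrite !phi0 a0 b0.
Qed.

Lemma delta_phi x z (c : K) : (x == z)%:R * (phi z / phi x * c) = (x == z)%:R * c.
Proof. by case: eqP => [->|_]; rewrite /= ?mul0r // divff ?phi0 // !mul1r. Qed.

Lemma alg_cp_cm_L x z :
  let Lm x y := phi y / phi x * (a / b * L x y) in
  \sum_y alg_cp x y * alg_cm y z
  + \sum_y (alg_dm x y * Lm y z + Lm x y * alg_dm y z) = (x == z)%:R * a.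
Proof.
move=> Lm; rewrite -big_split (@sum_relations x z _ (phi z / phi x * (a / b)) 0
  (phi z / phi x * (a / b)) (phi z / phi x * (b / a))
  (fun y => phi z / phi x * ((a / b) ^+ 2 * (L x y * L y z) + L x y * R y z + R x y * L y z))).
  by rewrite mul0r addr0 -mulrA divfK // delta_phi.
move=> y; rewrite /alg_cm /alg_cp /alg_dm /Lm /=; field.
by rewrite !phi0 a0 b0.
Qed.

Lemma alg_cp_cm_R x z :
  let Rm x y := phi y / phi x * (b / a * R x y) in
  \sum_y alg_cp x y * alg_cm y z
  + \sum_y (alg_dm x y * Rm y z + Rm x y * alg_dm y z) = (x == z)%:R * b.
Proof.
move=> Rm; rewrite -big_split (@sum_relations x z _ 0 (phi z / phi x * (b / a))
  (phi z / phi x * (a / b)) (phi z / phi x * (b / a))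
  (fun y => phi z / phi x * ((b / a) ^+ 2 * (R x y * R y z) + L x y * R y z + R x y * L y z))).
  by rewrite mul0r add0r -mulrA divfK // delta_phi.
move=> y; rewrite /alg_cm /alg_cp /alg_dm /Rm /=; field.
by rewrite !phi0 a0 b0.
Qed.

End CrossingAlgebra.

Local Arguments square_in : simpl never.

(** * The crossing change maps *)

Lemma VRing_two (n : nat) : 1 + 1 = 0 :> VRing n.
Proof. by rewrite -mpolyC1 -mpolyCD -[RHS]mpolyC0; congr mpolyC; apply/eqP. Qed.

Section CrossingMatrices.
Variables (n : nat) (Gp Gm : grid n) (i j v : 'I_n).
Hypothesis ji : nat_of_ord j = i.+1.
Hypothesis GmO : forall c, gO Gm c = gO Gp (tperm i j c).
Implicit Types (x y z : 'S_n) (c d r e : 'I_n) (Q : rect n).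

Definition rect_sum (w : rect n -> VRing n) (P : pred (rect n)) x y : VRing n :=
  \sum_(Q in empty_rects x y | P Q) w Q.

Definition monomial (e : 'I_n -> nat) : VRing n := \prod_(r < n) 'X_r ^+ e r.

Let u := gO Gp i.
Let l := gO Gp j.

(* The O's of the pentagon obtained from Q.  Its side on the circle between the
   two columns follows the circle of one diagram above row v and that of the
   other diagram below it, hence the conditions on the rows u and l. *)
Definition down_exp Q r : nat :=
  let: ((_, a), (_, b)) := Q in
  if r == u then ~~ arc b v u else if r == l then arc a v l
  else square_in Q (colO Gp r) r.

Definition up_exp Q r : nat :=
  let: ((_, a), (_, b)) := Q in
  if r == u then arc a v u : nat else if r == l then ~~ arc b v l : nat
  else square_in Q (colO Gp r) r.

Definition crosses Q : bool := hits_only j i v Q || hits_only i j v Q.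

Definition differential_matrix G x y : VRing n :=
  \sum_(Q in empty_rects x y) rect_weight G Q.
Definition straddle_matrix G c d := rect_sum (rect_weight G) (hits_only c d v).
Definition down_matrix := rect_sum (fun Q => monomial (down_exp Q)) crosses.
Definition up_matrix := rect_sum (fun Q => monomial (up_exp Q)) crosses.

Variables (K : fieldType) (iota : {rmorphism VRing n -> K}).
Hypothesis iota_inj : injective iota.
Let a : K := iota ('X_u : VRing n).
Let b : K := iota ('X_l : VRing n).
(** Records which of the rows [l] and [u] are passed on the way up from the point of [x] between the
    two columns to row [v]. *)
Let phi x : K := b ^+ arc (x j) v l / a ^+ arc (x j) v u.

Lemma neq_ij : i != j.
Proof. by rewrite ord_eqE ji; lia. Qed.

Lemma neq_ul : u != l.
Proof. by rewrite (inj_eq perm_inj) neq_ij. Qed.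

(* Both sides measure how the moving point on the circle between the columns goes
   past row r, relative to row v. *)
Lemma winding x y Q r : Q \in empty_rects x y ->
  (square_in Q j r + square_in Q i v + arc (y j) v r =
   square_in Q i r + square_in Q j v + arc (x j) v r)%N.
Proof.
case: Q => [[k p] [q s]]; rewrite in_empty_rects => /and4P[/= kq _ /eqP-> /eqP[-> ->]].
rewrite /square_in -!/(arc _ _ _).
have := arc_next ji kq; have := @arc_shift _ (x k) (x q) r v.
rewrite (inj_eq perm_inj) => /(_ kq).
have -> : arc (swapped x k q j) v r =
    if q == j then arc (x k) v r else if k == j then arc (x q) v r else arc (x j) v r.
  have [<-|qj] := eqVneq q j; first by rewrite swappedr.
  have [<-|kj] := eqVneq k j; first by rewrite swappedl.
  by rewrite swappedD // eq_sym.
have -> : arc (x j) v r =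
    if q == j then arc (x q) v r else if k == j then arc (x k) v r else arc (x j) v r.
  by case: eqP => [->|_] //; case: eqP => [->|_].
have : ~~ ((q == j) && (k == j)) by case: (q =P j) => //= <-.
move: (arc (x k) (x q) v) (arc (x k) v r) (arc (x k) (x q) r) (arc (x q) v r).
move: (q == j) (k == j) (arc (x j) v r) (arc k q j) (arc k q i).
by do 9 case.
Qed.

Lemma colO_minus r : colO Gm r = tperm i j (colO Gp r).
Proof.
apply: (@perm_inj _ (gO Gm)).
by rewrite permKV GmO tpermK permKV.
Qed.

Lemma monomial_split (e : 'I_n -> nat) :
  monomial e = 'X_u ^+ e u * 'X_l ^+ e l * \prod_(r | (r != u) && (r != l)) 'X_r ^+ e r.
Proof.
by rewrite /monomial (bigD1 u) //= (bigD1 l) 1?eq_sym ?neq_ul // mulrA.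
Qed.

Lemma colO_u : colO Gp u = i. Proof. exact: permK. Qed.
Lemma colO_l : colO Gp l = j. Proof. exact: permK. Qed.

Let other Q : VRing n :=
  \prod_(r | (r != u) && (r != l)) 'X_r ^+ square_in Q (colO Gp r) r.

Lemma weight_plus Q :
  rect_weight Gp Q = 'X_u ^+ square_in Q i u * 'X_l ^+ square_in Q j l * other Q.
Proof. by rewrite [LHS]monomial_split colO_u colO_l. Qed.

Lemma weight_minus Q :
  rect_weight Gm Q = 'X_u ^+ square_in Q j u * 'X_l ^+ square_in Q i l * other Q.
Proof.
rewrite [LHS]monomial_split !colO_minus colO_u colO_l tpermL tpermR; congr (_ * _).
apply: eq_bigr => r /andP[ru rl]; rewrite colO_minus tpermD //.
  by apply: contraNneq ru => e; rewrite /u e permKV.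
by apply: contraNneq rl => e; rewrite /l e permKV.
Qed.

Lemma weight_down (e p q r : 'I_n) (Q := ((e, p), (q, r)) : rect n) :
  monomial (down_exp Q) = 'X_u ^+ (~~ arc r v u) * 'X_l ^+ arc p v l * other Q.
Proof.
rewrite monomial_split /down_exp /= !eqxx eq_sym (negbTE neq_ul); congr (_ * _).
by apply: eq_bigr => m /andP[/negbTE-> /negbTE->].
Qed.

Lemma weight_up (e p q r : 'I_n) (Q := ((e, p), (q, r)) : rect n) :
  monomial (up_exp Q) = 'X_u ^+ arc p v u * 'X_l ^+ (~~ arc r v l) * other Q.
Proof.
rewrite monomial_split /up_exp /= !eqxx eq_sym (negbTE neq_ul); congr (_ * _).
by apply: eq_bigr => m /andP[/negbTE-> /negbTE->].
Qed.

Lemma iota_var_neq0 r : iota ('X_r : VRing n) != 0.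
Proof.
rewrite raddf_eq0 //; apply/eqP => /(congr1 (fun p : VRing n => msupp p)).
by rewrite msuppX msupp0.
Qed.

Let a_neq0 : a != 0 := iota_var_neq0 u.
Let b_neq0 : b != 0 := iota_var_neq0 l.

Lemma phi_neq0 x : phi x != 0.
Proof. by rewrite mulf_neq0 ?invr_eq0 ?expf_neq0 ?a_neq0 ?b_neq0. Qed.

Let twist Q : K := a ^+ square_in Q j v / b ^+ square_in Q j v
  * (b ^+ square_in Q i v / a ^+ square_in Q i v).

(** The diagrams differ only in the columns of $O_u$ and $O_l$, so the weights differ by powers of
    [a] and [b]; [winding] in rows [u] and [l] expresses these through [x j], [y j] and the squares
    of row [v]. *)
Lemma twist_minus x y Q : Q \in empty_rects x y ->
  iota (rect_weight Gm Q) = phi y / phi x * (twist Q * iota (rect_weight Gp Q)).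
Proof.
move=> Qxy; have wu := congr1 (fun m => a ^+ m) (winding u Qxy).
have wl := congr1 (fun m => b ^+ m) (winding l Qxy).
rewrite weight_plus weight_minus !rmorphM !rmorphXn /= -/a -/b mulrA.
have a0 := a_neq0; have b0 := b_neq0.
have {}a0 (m : bool) : a ^+ m != 0 by rewrite expf_neq0.
have {}b0 (m : bool) : b ^+ m != 0 by rewrite expf_neq0.
rewrite mulrA; congr (_ * _).
move: wu wl; rewrite /phi /twist !exprD.
move: (a0 (square_in Q j u)) (a0 (square_in Q i v)) (a0 (arc (y j) v u))
  (a0 (square_in Q i u)) (a0 (square_in Q j v)) (a0 (arc (x j) v u)).
move: (b0 (square_in Q j l)) (b0 (square_in Q i v)) (b0 (arc (y j) v l))
  (b0 (square_in Q i l)) (b0 (square_in Q j v)) (b0 (arc (x j) v l)).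
move: (a ^+ square_in Q j u) (a ^+ square_in Q i v) (a ^+ arc (y j) v u)
  (a ^+ square_in Q i u) (a ^+ square_in Q j v) (a ^+ arc (x j) v u).
move: (b ^+ square_in Q j l) (b ^+ square_in Q i v) (b ^+ arc (y j) v l)
  (b ^+ square_in Q i l) (b ^+ square_in Q j v) (b ^+ arc (x j) v l).
move=> b1 b2 b3 b4 b5 b6 a1 a2 a3 a4 a5 a6.
move=> b10 b20 b30 b40 b50 b60 a10 a20 a30 a40 a50 a60 wu wl.
have -> : a1 = a4 * a5 * a6 / (a2 * a3) by rewrite -wu; field; rewrite a20 a30.
have -> : b4 = b1 * b2 * b3 / (b5 * b6) by rewrite wl; field; rewrite b50 b60.
by field; rewrite b60 a60 b50 a20; rewrite ?a30 ?b30.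
Qed.

Lemma twist_straddle Q : hits_only j i v Q -> twist Q = a / b.
Proof.
by case/andP; rewrite /twist => -> /negbTE->; rewrite !expr1 !expr0 divr1 mulr1.
Qed.

Lemma twist_straddle' Q : hits_only i j v Q -> twist Q = b / a.
Proof.
by case/andP; rewrite /twist => -> /negbTE->; rewrite !expr1 !expr0 divr1 mul1r.
Qed.

Lemma twist_balanced Q : balanced i j v Q -> twist Q = 1.
Proof.
rewrite /balanced /twist => /eqP->; case: square_in.
  by rewrite !expr1; field; rewrite a_neq0 b_neq0.
by rewrite !expr0 divr1 mulr1.
Qed.

(** The rectangle begins between the columns [i] and [j], so its left side lies on their common
    circle and carries the moving point up from [x j] to [y j]. *)
Lemma left_straddle x y Q : Q \in empty_rects x y -> hits_only j i v Q ->
  [/\ Q.1.2 = x j, Q.2.2 = y j, forall r, square_in Q i r = false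
    & forall r, (square_in Q j r + arc (y j) v r = 1 + arc (x j) v r)%N].
Proof.
move=> Qxy; have := fun r => winding r Qxy; move: Qxy.
case: Q => [[k p] [q s]]; rewrite in_empty_rects /hits_only /=.
case/and4P=> [kq _ /eqP-> /eqP[-> ->]] w /andP[/andP[kj vj]]; rewrite negb_and vj orbF.
rewrite -!/(arc _ _ _) in kj vj * => ki.
have kE : k = j.
  have := arc_next ji kq; rewrite kj (negbTE ki).
  by case: (k =P j) => // _; case: (q == j).
have si r : square_in (k, x k, (q, x q)) i r = false.
  by rewrite /square_in -!/(arc _ _ _) (negbTE ki).
have yj : swapped x k q j = x q by rewrite -kE swappedl.
split=> [||//|r]; rewrite ?yj ?kE //.
by have := w r; rewrite !si {2}/square_in -!/(arc _ _ _) kj vj yj kE addn0 add0n.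
Qed.

(** Mirror image: the right side lies on the common circle and carries the moving point down from
    [x j] to [y j]. *)
Lemma right_straddle x y Q : Q \in empty_rects x y -> hits_only i j v Q ->
  [/\ Q.1.2 = y j, Q.2.2 = x j, forall r, square_in Q j r = false
    & forall r, (square_in Q i r + arc (x j) v r = 1 + arc (y j) v r)%N].
Proof.
move=> Qxy; have := fun r => winding r Qxy; move: Qxy.
case: Q => [[k p] [q s]]; rewrite in_empty_rects /hits_only /=.
case/and4P=> [kq _ /eqP-> /eqP[-> ->]] w /andP[/andP[ki vi]]; rewrite negb_and vi orbF.
rewrite -!/(arc _ _ _) in ki vi * => kj.
have qE : q = j.
  have := arc_next ji kq; rewrite ki (negbTE kj).
  by case: (q =P j) => // _; case: (k == j).
have sj r : square_in (k, x k, (q, x q)) j r = false.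
  by rewrite /square_in -!/(arc _ _ _) (negbTE kj).
have yj : swapped x k q j = x k by rewrite -qE swappedr.
split=> [||//|r]; rewrite ?yj ?qE //.
by have := w r; rewrite !sj {1}/square_in -!/(arc _ _ _) ki vi yj qE addn0 add0n => ->.
Qed.

(** Shows that the entries of [alg_cm], written with denominators, are polynomial. The factor is
    [phi y] because the target state belongs to G-; for [twist_up] it is the source state. *)
Lemma twist_down x y Q : Q \in empty_rects x y -> crosses Q ->
  iota (monomial (down_exp Q)) = phi y *
    ((if hits_only j i v Q then a / b else 1) * iota (rect_weight Gp Q)).
Proof.
move=> Qxy; case/boolP: (hits_only j i v Q) => h /= h'.
  have [e1 e2 si] := left_straddle Qxy h; rewrite weight_plus si => /(_ l).
  case: Q Qxy e1 e2 {h h' si} => [[k p] [q s]] _ /= -> ->.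
  rewrite weight_down !rmorphM !rmorphXn /= -/a -/b /phi.
  case: (square_in _ _ _); case: (arc (y j) v l); case: (arc (x j) v l) => //= _;
    case: (arc (y j) v u) => /=; by field; rewrite ?a_neq0 ?b_neq0 ?oner_neq0.
rewrite /crosses (negbTE h) /= in h'.
have [e1 e2 si] := right_straddle Qxy h'; rewrite weight_plus si => /(_ u).
case: Q Qxy e1 e2 {h h' si} => [[k p] [q s]] _ /= -> ->.
rewrite weight_down !rmorphM !rmorphXn /= -/a -/b /phi.
case: (square_in _ _ _); case: (arc (y j) v u); case: (arc (x j) v u) => //= _;
    case: (arc (y j) v l) => /=; by field; rewrite ?a_neq0 ?b_neq0 ?oner_neq0.
Qed.

Lemma twist_up x y Q : Q \in empty_rects x y -> crosses Q ->
  iota (monomial (up_exp Q)) = (phi x)^-1 *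
    ((if hits_only j i v Q then 1 else b / a) * iota (rect_weight Gp Q)).
Proof.
move=> Qxy; case/boolP: (hits_only j i v Q) => h /= h'.
  have [e1 e2 si] := left_straddle Qxy h; rewrite weight_plus si => /(_ l).
  case: Q Qxy e1 e2 {h h' si} => [[k p] [q s]] _ /= -> ->.
  rewrite weight_up !rmorphM !rmorphXn /= -/a -/b /phi.
  case: (square_in _ _ _); case: (arc (y j) v l); case: (arc (x j) v l) => //= _;
    case: (arc (x j) v u) => /=; by field; rewrite ?a_neq0 ?b_neq0 ?oner_neq0.
rewrite /crosses (negbTE h) /= in h'.
have [e1 e2 si] := right_straddle Qxy h'; rewrite weight_plus si => /(_ u).
case: Q Qxy e1 e2 {h h' si} => [[k p] [q s]] _ /= -> ->.
rewrite weight_up !rmorphM !rmorphXn /= -/a -/b /phi.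
case: (square_in _ _ _); case: (arc (y j) v u); case: (arc (x j) v u) => //= _;
    case: (arc (x j) v l) => /=; by field; rewrite ?a_neq0 ?b_neq0 ?oner_neq0.
Qed.

(** One weight per square, as [straddle_relations] requires; the product over a column is the
    variable of its O. *)
Let WK c r : K := if gO Gp c == r then iota 'X_r else 1.

Lemma square_weight_iota Q : square_weight WK Q = iota (rect_weight Gp Q).
Proof.
rewrite /square_weight exchange_big rmorph_prod; apply: eq_bigr => r _ /=.
rewrite (bigD1 (colO Gp r)) //= /WK permKV eqxx rmorphXn /=.
rewrite big1 ?mulr1 // => c cr; case: (gO Gp c =P r) => [e|_]; last by rewrite expr1n.
by rewrite -e /colO permK eqxx in cr.
Qed.

Lemma column_weight_iota c : \prod_r WK c r = iota 'X_(gO Gp c).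
Proof.
rewrite (bigD1 (gO Gp c)) //= /WK eqxx big1 ?mulr1 // => r.
by rewrite eq_sym => /negbTE->.
Qed.

Let N := part_matrix WK (balanced i j v).
Let L := part_matrix WK (hits_only j i v).
Let Rt := part_matrix WK (hits_only i j v).

Lemma part_matrix_iota P x y :
  part_matrix WK P x y = \sum_(Q in empty_rects x y | P Q) iota (rect_weight Gp Q).
Proof. by apply: eq_bigr => Q _; apply: square_weight_iota. Qed.

Lemma sum_by_straddling x y (F : rect n -> K) :
  \sum_(Q in empty_rects x y) F Q =
  \sum_(Q in empty_rects x y | balanced i j v Q) F Q
  + \sum_(Q in empty_rects x y | hits_only j i v Q) F Q
  + \sum_(Q in empty_rects x y | hits_only i j v Q) F Q.
Proof.
rewrite !big_mkcondr -!big_split /=; apply: eq_bigr => Q _.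
rewrite /balanced /hits_only; case: square_in; case: square_in => /=.
all: by rewrite ?addr0 ?add0r.
Qed.

Lemma iota_plus x y : iota (differential_matrix Gp x y) = alg_dp N L Rt x y.
Proof.
rewrite /alg_dp /N /L /Rt !part_matrix_iota -sum_by_straddling rmorph_sum.
by [].
Qed.

Lemma iota_straddle c d x y :
  iota (straddle_matrix Gp c d x y) = part_matrix WK (hits_only c d v) x y.
Proof. by rewrite part_matrix_iota rmorph_sum. Qed.

Lemma iota_straddle_minus_left x y :
  iota (straddle_matrix Gm j i x y) = phi y / phi x * (a / b * L x y).
Proof.
rewrite rmorph_sum /L part_matrix_iota !mulr_sumr; apply: eq_bigr => Q /andP[Qxy h].
by rewrite /= (twist_minus Qxy) twist_straddle.
Qed.

Lemma iota_straddle_minus_right x y :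
  iota (straddle_matrix Gm i j x y) = phi y / phi x * (b / a * Rt x y).
Proof.
rewrite rmorph_sum /Rt part_matrix_iota !mulr_sumr; apply: eq_bigr => Q /andP[Qxy h].
by rewrite /= (twist_minus Qxy) twist_straddle'.
Qed.

Lemma iota_minus x y : iota (differential_matrix Gm x y) = alg_dm N L Rt a b phi x y.
Proof.
rewrite /alg_dm !mulrDr -iota_straddle_minus_left -iota_straddle_minus_right.
rewrite !rmorph_sum /= sum_by_straddling; congr (_ + _ + _).
rewrite /N part_matrix_iota mulr_sumr; apply: eq_bigr => Q /andP[Qxy h].
by rewrite /= (twist_minus Qxy) twist_balanced // mul1r.
Qed.

Lemma sum_crosses x y (F : rect n -> K) :
  \sum_(Q in empty_rects x y | crosses Q) F Q =
  \sum_(Q in empty_rects x y | hits_only j i v Q) F Q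
  + \sum_(Q in empty_rects x y | hits_only i j v Q) F Q.
Proof.
rewrite !big_mkcondr -!big_split /=; apply: eq_bigr => Q _.
rewrite /crosses /hits_only; case: square_in; case: square_in => /=.
all: by rewrite ?addr0 ?add0r.
Qed.

Lemma hits_only_asym c d Q : hits_only c d v Q -> hits_only d c v Q = false.
Proof. by case/andP=> h /negbTE h'; rewrite /hits_only h h'. Qed.

Lemma iota_down x y : iota (down_matrix x y) = alg_cm L Rt a b phi x y.
Proof.
rewrite /alg_cm /L /Rt !part_matrix_iota rmorph_sum /= sum_crosses mulrDr !mulr_sumr.
congr (_ + _); apply: eq_bigr => Q /andP[Qxy h].
  by rewrite (twist_down Qxy) /crosses ?h.
by rewrite (twist_down Qxy) /crosses ?h ?orbT // (hits_only_asym h) mul1r.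
Qed.

Lemma iota_up x y : iota (up_matrix x y) = alg_cp L Rt a b phi x y.
Proof.
rewrite /alg_cp /L /Rt !part_matrix_iota rmorph_sum /= sum_crosses mulrDr !mulr_sumr.
congr (_ + _); apply: eq_bigr => Q /andP[Qxy h].
  by rewrite (twist_up Qxy) /crosses ?h // mul1r.
by rewrite (twist_up Qxy) /crosses ?h ?orbT // (hits_only_asym h).
Qed.

Lemma iota_addxx (w : K) : w + w = 0.
Proof.
rewrite -[w]mulr1 -mulrDr -(rmorph1 iota) -rmorphD.
by rewrite VRing_two rmorph0 mulr0.
Qed.

Lemma gt1_n : (1 < n)%N.
Proof. by have := ltn_ord j; rewrite ji; lia. Qed.

Let rel x z := straddle_relations WK v iota_addxx neq_ij x z gt1_n.

Let LL x z : \sum_y L x y * L y z = 0. Proof. by case: (rel x z). Qed.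
Let RR x z : \sum_y Rt x y * Rt y z = 0. Proof. by case: (rel x z). Qed.

Let NL x z : \sum_y (N x y * L y z + L x y * N y z) = (x == z)%:R * b.
Proof. by case: (rel x z) => _ _ -> _; rewrite column_weight_iota. Qed.

Let NR x z : \sum_y (N x y * Rt y z + Rt x y * N y z) = (x == z)%:R * a.
Proof. by case: (rel x z) => _ _ _ ->; rewrite column_weight_iota. Qed.

Definition commutator (D H : 'S_n -> 'S_n -> VRing n) x z : VRing n :=
  \sum_y (D x y * H y z + H x y * D y z).

(** The identity is proved in [K], where [a] and [b] are invertible, and pulled back along the
    injection [iota]. *)
Lemma down_chain x z :
  \sum_y down_matrix x y * differential_matrix Gm y z =
  \sum_y differential_matrix Gp x y * down_matrix y z.
Proof.
apply: iota_inj; rewrite !rmorph_sum /=.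
under eq_bigr do rewrite rmorphM /= iota_down iota_minus.
under [RHS]eq_bigr do rewrite rmorphM /= iota_down iota_plus.
exact: (alg_cm_chain iota_addxx a_neq0 b_neq0 phi_neq0 LL RR NL NR).
Qed.

Lemma up_chain x z :
  \sum_y up_matrix x y * differential_matrix Gp y z =
  \sum_y differential_matrix Gm x y * up_matrix y z.
Proof.
apply: iota_inj; rewrite !rmorph_sum /=.
under eq_bigr do rewrite rmorphM /= iota_up iota_plus.
under [RHS]eq_bigr do rewrite rmorphM /= iota_up iota_minus.
exact: (alg_cp_chain iota_addxx a_neq0 b_neq0 phi_neq0 LL RR NL NR).
Qed.

Lemma iota_delta x z r : iota ((x == z)%:R * 'X_r) = (x == z)%:R * iota 'X_r.
Proof. by rewrite rmorphM rmorph_nat. Qed.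

Lemma down_up_left x z :
  \sum_y down_matrix x y * up_matrix y z
  + commutator (differential_matrix Gp) (straddle_matrix Gp j i) x z
  = (x == z)%:R * 'X_l.
Proof.
apply: iota_inj; rewrite rmorphD !rmorph_sum /= iota_delta.
under eq_bigr do rewrite rmorphM /= iota_down iota_up.
under [X in _ + X]eq_bigr do rewrite rmorphD !rmorphM /= !iota_plus !iota_straddle.
exact: (alg_cm_cp_L iota_addxx a_neq0 b_neq0 phi_neq0 LL RR NL NR).
Qed.

Lemma down_up_right x z :
  \sum_y down_matrix x y * up_matrix y z
  + commutator (differential_matrix Gp) (straddle_matrix Gp i j) x z
  = (x == z)%:R * 'X_u.
Proof.
apply: iota_inj; rewrite rmorphD !rmorph_sum /= iota_delta.
under eq_bigr do rewrite rmorphM /= iota_down iota_up.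
under [X in _ + X]eq_bigr do rewrite rmorphD !rmorphM /= !iota_plus !iota_straddle.
exact: (alg_cm_cp_R iota_addxx a_neq0 b_neq0 phi_neq0 LL RR NL NR).
Qed.

(** In G- column [j] carries $O_u$, so the left part yields $V_u$ here, whereas on G+ it yields
    $V_l$. *)
Lemma up_down_left x z :
  \sum_y up_matrix x y * down_matrix y z
  + commutator (differential_matrix Gm) (straddle_matrix Gm j i) x z
  = (x == z)%:R * 'X_u.
Proof.
apply: iota_inj; rewrite rmorphD !rmorph_sum /= iota_delta.
under eq_bigr do rewrite rmorphM /= iota_down iota_up.
under [X in _ + X]eq_bigr do
  rewrite rmorphD !rmorphM /= !iota_minus !iota_straddle_minus_left.
exact: (alg_cp_cm_L iota_addxx a_neq0 b_neq0 phi_neq0 LL RR NL NR).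
Qed.

Lemma up_down_right x z :
  \sum_y up_matrix x y * down_matrix y z
  + commutator (differential_matrix Gm) (straddle_matrix Gm i j) x z
  = (x == z)%:R * 'X_l.
Proof.
apply: iota_inj; rewrite rmorphD !rmorph_sum /= iota_delta.
under eq_bigr do rewrite rmorphM /= iota_down iota_up.
under [X in _ + X]eq_bigr do
  rewrite rmorphD !rmorphM /= !iota_minus !iota_straddle_minus_right.
exact: (alg_cp_cm_R iota_addxx a_neq0 b_neq0 phi_neq0 LL RR NL NR).
Qed.

End CrossingMatrices.

(** * Gradings *)

Section Gradings.
Variable n : nat.
Implicit Types (x y m s t : 'S_n) (i j k q c d r a b e : 'I_n) (Q : rect n).

Let ind (p : bool) : rat := p%:R.

Definition below s t : rat := \sum_(c < n) \sum_(d < n) ind (c < d)%N * ind (s c < t d)%N.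
(** Compares a state point with a marking: the marking lies half a unit to the upper right of
    [(d, t d)], so strict inequalities become weak. *)
Definition below_eq s t : rat := \sum_(c < n) \sum_(d < n) ind (c <= d)%N * ind (s c <= t d)%N.

Lemma Icount_enum (f g : 'I_n -> nat * nat) :
  (Icount [seq f c | c <- enum 'I_n] [seq g c | c <- enum 'I_n])%:R =
  \sum_(c < n) \sum_(d < n) ind ((f c).1 < (g d).1)%N * ind ((f c).2 < (g d).2)%N.
Proof.
rewrite /Icount big_map big_enum natr_sum; apply: eq_bigr => c _.
rewrite big_map big_enum natr_sum; apply: eq_bigr => d _.
by rewrite /ind -natrM mulnb.
Qed.

Lemma MfunE m x :
  Mfun m x = below x x - below_eq x m - below m x + below m m + 1.
Proof.
rewrite /Mfun /Jdiff /Jform !natrD /state_points /mark_points !Icount_enum /=.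
have D (c d : nat) : (c.*2 < d.*2)%N = (c < d)%N by rewrite ltn_double.
have D1 (c d : nat) : (c.*2 < d.*2.+1)%N = (c <= d)%N by rewrite ltnS leq_double.
have D2 (c d : nat) : (c.*2.+1 < d.*2)%N = (c < d)%N by apply/idP/idP; lia.
have D3 (c d : nat) : (c.*2.+1 < d.*2.+1)%N = (c < d)%N by rewrite ltnS; apply/idP/idP; lia.
set A := below x x.
have -> : \sum_(c < n) \sum_(d < n) ind (c.*2 < d.*2.+1)%N * ind ((x c).*2 < (m d).*2.+1)%N =
    below_eq x m.
  by apply: eq_bigr => c _; apply: eq_bigr => d _; rewrite !D1.
have -> : \sum_(c < n) \sum_(d < n) ind (c.*2.+1 < d.*2)%N * ind ((m c).*2.+1 < (x d).*2)%N =
    below m x.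
  by apply: eq_bigr => c _; apply: eq_bigr => d _; rewrite !D2.
have -> : \sum_(c < n) \sum_(d < n) ind (c.*2.+1 < d.*2.+1)%N * ind ((m c).*2.+1 < (m d).*2.+1)%N =
    below m m.
  by apply: eq_bigr => c _; apply: eq_bigr => d _; rewrite !D3.
have -> : \sum_(c < n) \sum_(d < n) ind (c.*2 < d.*2)%N * ind ((x c).*2 < (x d).*2)%N = A.
  by apply: eq_bigr => c _; apply: eq_bigr => d _; rewrite !D.
by field.
Qed.

Lemma sum_swapped (g : 'I_n -> 'I_n -> rat) x k q : k != q ->
  \sum_(c < n) g c (x c) - \sum_(c < n) g c (swapped x k q c) =
  g k (x k) + g q (x q) - g k (x q) - g q (x k).
Proof.
move=> kq; rewrite (bigD1 k) //= (bigD1 q) 1?eq_sym //=.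
rewrite [X in _ - X](bigD1 k) //= [X in _ - (_ + X)](bigD1 q) 1?eq_sym //=.
rewrite swappedl swappedr.
rewrite [X in _ - (_ + (_ + X))](eq_bigr (fun c => g c (x c))); first by ring.
by move=> c /andP[ck cq]; rewrite swappedD.
Qed.

(* The points of the graph of m in the planar rectangle with opposite corners
   (k, a) and (q, b), counted with the orientation of the rectangle as sign. *)
Definition signed_count m k q a b : rat :=
  \sum_(c < n) (ind (k <= c)%N - ind (q <= c)%N) * (ind (a <= m c)%N - ind (b <= m c)%N).

Let indN p : ind (~~ p) = 1 - ind p.
Proof. by case: p; rewrite /ind /= ?subrr ?subr0. Qed.

Let ind_ltn (p r : nat) : ind (p < r)%N = 1 - ind (r <= p)%N.
Proof. by rewrite ltnNge indN. Qed.

Lemma below_eq_swapl x m k q : k != q ->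
  below_eq x m - below_eq (swapped x k q) m = signed_count m k q (x k) (x q).
Proof.
move=> kq; rewrite (sum_swapped (fun c r => \sum_(d < n) ind (c <= d)%N * ind (r <= m d)%N)) //.
rewrite -big_split -!sumrB; apply: eq_bigr => c _ /=; ring.
Qed.

Lemma below_swapr x m k q : k != q ->
  below m x - below m (swapped x k q) = signed_count m k q (x k) (x q).
Proof.
move=> kq; rewrite /below exchange_big [X in _ - X]exchange_big.
rewrite (sum_swapped (fun c r => \sum_(d < n) ind (d < c)%N * ind (m d < r)%N)) //.
rewrite -big_split -!sumrB; apply: eq_bigr => c _ /=; rewrite !ind_ltn; ring.
Qed.

Lemma below_eq_below x : below_eq x x = below x x + n%:R.
Proof.
have -> : n%:R = \sum_(c : 'I_n) (1 : rat) by rewrite sumr_const card_ord.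
rewrite -big_split; apply: eq_bigr => c _ /=.
rewrite (bigD1 c) //= [X in _ = X + _](bigD1 c) //= !leqnn !ltnn /ind !mulr1 mul0r add0r addrC.
congr (_ + _); apply: eq_bigr => d dc.
rewrite [(c < d)%N]ltn_neqAle [(x c < x d)%N]ltn_neqAle.
have -> : nat_of_ord c != nat_of_ord d by rewrite -ord_eqE eq_sym.
by have -> : nat_of_ord (x c) != nat_of_ord (x d)
  by rewrite -ord_eqE (inj_eq perm_inj) eq_sym.
Qed.

Lemma below_self_swapped x k q : k != q ->
  below x x - below (swapped x k q) (swapped x k q) =
  2 * signed_count x k q (x k) (x q) - 1.
Proof.
move=> kq; have B := below_eq_below x; have B' := below_eq_below (swapped x k q).
have -> : below x x = below_eq x x - n%:R by rewrite B; ring.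
have -> : forall z, below z z = below_eq z z - n%:R by move=> z; rewrite below_eq_below; ring.
have E := below_eq_swapl x x kq; set y := swapped x k q in B' E *.
(* The swap is made in one argument at a time. The second time the other argument is already swapped
   at the corners, hence the -1. *)
suff E' : below_eq y x - below_eq y y = signed_count x k q (x k) (x q) - 1.
  by move: E E'; lra.
rewrite /below_eq exchange_big [X in _ - X]exchange_big.
rewrite (sum_swapped (fun c r => \sum_(d < n) ind (d <= c)%N * ind (y d <= r)%N)) //.
rewrite -big_split -!sumrB /=.
have qk : q != k by rewrite eq_sym.
have D (F : 'I_n -> rat) : \sum_(c < n) F c = F k + (F q + \sum_(c | (c != k) && (c != q)) F c).
  by rewrite (bigD1 k) //= (bigD1 q).
rewrite [LHS]D /signed_count D.
rewrite [X in _ + (_ + X) = _](eq_bigr (fun c =>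
  (ind (k <= c)%N - ind (q <= c)%N) * (ind (x k <= x c)%N - ind (x q <= x c)%N))).
  rewrite swappedl swappedr !leqnn.
  have xkq : x k != x q by rewrite (inj_eq perm_inj).
  move: kq xkq; rewrite !ord_eqE /ind; by do 2 case: ltngtP => //= ?; move=> *; ring.
move=> c /andP[ck cq]; rewrite /y swappedD //.
have lt p p' : p != p' :> 'I_n -> ind (p <= p')%N = 1 - ind (p' <= p)%N.
  by move=> h; rewrite -ind_ltn [(p < p')%N]ltn_neqAle -ord_eqE h.
rewrite (lt k) 1?eq_sym // (lt q) 1?eq_sym //.
rewrite (lt (x k)) 1?eq_sym ?(inj_eq perm_inj) //.
rewrite (lt (x q)) 1?eq_sym ?(inj_eq perm_inj) //; ring.
Qed.

(** Toroidal and planar counts differ by terms in one coordinate only; summed over the graph of a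
    permutation, these do not depend on the permutation. *)
Lemma sum_arcs x y k q a b :
  \sum_(c < n) ind (arc k q c && arc a b (x c)) - signed_count x k q a b =
  \sum_(c < n) ind (arc k q c && arc a b (y c)) - signed_count y k q a b.
Proof.
have arcE (p r : 'I_n) d : ind (arc p r d) = ind (p <= d)%N - ind (r <= d)%N + ind (r < p)%N.
  suff : (arc p r d + (r <= d) = (p <= d) + (r < p))%N.
    by move/(congr1 (fun h : nat => h%:R : rat)); rewrite !natrD /ind; lra.
  by arc_lia.
have T s : \sum_(c < n) ind (arc k q c && arc a b (s c)) - signed_count s k q a b =
    \sum_(c < n) ((ind (k <= c)%N - ind (q <= c)%N + ind (q < k)%N) * ind (b < a)%N)
    + \sum_(r < n) (ind (q < k)%N * (ind (a <= r)%N - ind (b <= r)%N)).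
  rewrite [X in _ = _ + X](reindex_inj (@perm_inj _ s)) -big_split /signed_count -sumrB.
  apply: eq_bigr => c _; rewrite /ind -mulnb natrM -!/(ind _) !arcE /=; ring.
by rewrite !T.
Qed.

Definition hits m Q : nat := \sum_(c < n) square_in Q c (m c).

(** The planar counts become toroidal by [sum_arcs], and an empty rectangle, taken half-open, meets
    [x] only in its SW corner. *)
Lemma Mfun_rect m x y Q : Q \in empty_rects x y ->
  Mfun m x - Mfun m y = 1 - 2 * (hits m Q)%:R.
Proof.
case: Q => [[k a] [q b]]; rewrite in_empty_rects.
move=> /and4P[/= kq /forallP e /eqP-> /eqP[-> ->]].
have xkq : x k != x q by rewrite (inj_eq perm_inj).
have hitsE s : (hits s (corners x k q))%:R =
    \sum_(c < n) ind (arc k q c && arc (x k) (x q) (s c)).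
  by rewrite natr_sum; apply: eq_bigr.
have hx : \sum_(c < n) ind (arc k q c && arc (x k) (x q) (x c)) = 1.
  rewrite (bigD1 k) //= !arc_left // big1 ?addr0 // => c ck.
  case: (boolP (_ && _)) => // /andP[kc ac].
  by have := e c; rewrite in_interiorE !between_arc ck kc ac (inj_eq perm_inj) ck.
have := sum_arcs m x k q (x k) (x q); rewrite -hitsE hx !MfunE /corners.
move: (below_self_swapped x kq) (below_eq_swapl x m kq) (below_swapr x m kq); lra.
Qed.

(** As the columns are adjacent, the only comparisons that change are those of the two markings with
    each other and with the state point on the circle between them. *)
Lemma Mfun_columns_swapped m x i j : nat_of_ord j = i.+1 ->
  Mfun (swapped m i j) x - Mfun m x =
  2 * (ind (m i < x j)%N - ind (m j < x j)%N) + 1 - 2 * ind (m i < m j)%N.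
Proof.
move=> ji; have ij : i != j by rewrite ord_eqE ji; lia.
have only (F : 'I_n -> rat) (c0 : 'I_n) (h : 'I_n -> rat) :
    (forall c, h c = ind (c == c0)) -> \sum_(c < n) h c * F c = F c0.
  move=> hE; rewrite (bigD1 c0) //= hE eqxx mul1r big1 ?addr0 // => c cc.
  by rewrite hE (negbTE cc) mul0r.
have E1 : below m m - below (swapped m i j) (swapped m i j) = 2 * ind (m i < m j)%N - 1.
  rewrite below_self_swapped // /signed_count (only _ i) => [|c].
    by rewrite leqnn ltnNge indN.
  by rewrite ji /ind ord_eqE; case: (ltngtP c i) => _; rewrite ?subr0 ?subrr.
have E2 : below_eq x m - below_eq x (swapped m i j) = ind (m i < x j)%N - ind (m j < x j)%N.
  rewrite /below_eq exchange_big [X in _ - X]exchange_big.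
  rewrite (sum_swapped (fun c r => \sum_(d < n) ind (d <= c)%N * ind (x d <= r)%N)) //.
  rewrite -big_split -!sumrB /= !ind_ltn.
  rewrite (eq_bigr (fun d => (ind (d <= j)%N - ind (d <= i)%N) *
    (ind (x d <= m j)%N - ind (x d <= m i)%N))) => [|d _]; last by ring.
  rewrite (only _ j) => [|c]; first by ring.
  by rewrite /ind ord_eqE ji -?[(c <= i)%N]ltnS;
    case: (ltngtP c i.+1) => _; rewrite ?subr0 ?subrr.
have E3 : below m x - below (swapped m i j) x = ind (m i < x j)%N - ind (m j < x j)%N.
  rewrite (sum_swapped (fun c r => \sum_(d < n) ind (c < d)%N * ind (r < x d)%N)) //.
  rewrite -big_split -!sumrB /=.
  rewrite (eq_bigr (fun d => (ind (i < d)%N - ind (j < d)%N) *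
    (ind (m i < x d)%N - ind (m j < x d)%N))) => [|d _]; last by ring.
  rewrite (only _ j) => [|c]; first by ring.
  by rewrite /ind ord_eqE ji -?[(c <= i)%N]ltnS;
    case: (ltngtP c i.+1) => _; rewrite ?subr0 ?subrr.
by rewrite !MfunE; lra.
Qed.

End Gradings.

(** * The sign of the crossing *)

Definition cyclically_ordered (a b c : nat) : bool :=
  [|| a < b < c, b < c < a | c < a < b]%N.

Section CrossingSign.
Variables (n : nat) (Gp Gm : grid n) (i j : 'I_n).
Hypothesis Gpm_cross : cross_commutation Gp Gm i j.
Hypothesis Gpm_sign : changes_positive_crossing Gp Gm i j.

Let pair c d : bool := ((c == i) && (d == j)) || ((c == j) && (d == i)).

Let pairP c d : pair c d -> [/\ gO Gm d = gO Gp c, gX Gm d = gX Gp c,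
  gO Gm c = gO Gp d & gX Gm c = gX Gp d].
Proof.
have [_ _ _ GmO GmX] := Gpm_cross.
by case/orP => /andP[/eqP-> /eqP->]; rewrite !GmO !GmX tpermL tpermR.
Qed.

Let plusO c d (r := gO Gp d) (k := colX Gp r) : pair c d ->
  strictly_between r (gX Gp c) (gO Gp c) -> strictly_between c d k ->
  (gX Gp c < gO Gp c)%N != (d < k)%N.
Proof.
have [pos _] := Gpm_sign => cd h1 h2; have := pos c r.
have e : colO Gp r = d by exact: permK.
rewrite /positive_at /strand_crossing /is_crossing e -/k h1 h2 /=; apply.
by rewrite /r; case/orP: cd => /andP[/eqP-> /eqP->]; rewrite !inE !eqxx ?orbT.
Qed.

Let plusX c d (r := gX Gp d) (k := colO Gp r) : pair c d ->
  strictly_between r (gX Gp c) (gO Gp c) -> strictly_between c k d ->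
  (gX Gp c < gO Gp c)%N != (k < d)%N.
Proof.
have [pos _] := Gpm_sign => cd h1 h2; have := pos c r.
have e : colX Gp r = d by exact: permK.
rewrite /positive_at /strand_crossing /is_crossing e -/k h1 h2 /=; apply.
by rewrite /r; case/orP: cd => /andP[/eqP-> /eqP->]; rewrite !inE !eqxx ?orbT.
Qed.

(** In G- the strand through column [c] carries the markings of column [d] of G+; the sign condition
    is translated back to G+. *)
Let minusO c d (r := gO Gp c) (k := colX Gp r) : pair c d -> k != i -> k != j ->
  strictly_between r (gX Gp d) (gO Gp d) -> strictly_between c d k ->
  (gX Gp d < gO Gp d)%N = (d < k)%N.
Proof.
have [_ neg] := Gpm_sign => cd ki kj h1 h2; have := neg c r.
have [e1 e2 e3 e4] := pairP cd.
have e : colO Gm r = d by rewrite /r -e1; exact: permK.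
have ek : colX Gm r = k.
  have [_ _ _ _ GmX] := Gpm_cross.
  by apply: (@perm_inj _ (gX Gm)); rewrite permKV GmX tpermD 1?eq_sym // permKV.
rewrite /positive_at /strand_crossing /is_crossing e ek e3 e4 h1 h2 /= negbK.
move=> h; suff /h/eqP : ((c == i) && (r \in [:: gO Gm j; gX Gm j])
    || (c == j) && (r \in [:: gO Gm i; gX Gm i])) by [].
by rewrite /r -e1; case/orP: cd => /andP[/eqP-> /eqP->]; rewrite !inE !eqxx ?orbT.
Qed.

Let minusX c d (r := gX Gp c) (k := colO Gp r) : pair c d -> k != i -> k != j ->
  strictly_between r (gX Gp d) (gO Gp d) -> strictly_between c k d ->
  (gX Gp d < gO Gp d)%N = (k < d)%N.
Proof.
have [_ neg] := Gpm_sign => cd ki kj h1 h2; have := neg c r.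
have [e1 e2 e3 e4] := pairP cd.
have e : colX Gm r = d by rewrite /r -e2; exact: permK.
have ek : colO Gm r = k.
  have [_ _ _ GmO _] := Gpm_cross.
  by apply: (@perm_inj _ (gO Gm)); rewrite permKV GmO tpermD 1?eq_sym // permKV.
rewrite /positive_at /strand_crossing /is_crossing e ek e3 e4 h1 h2 /= negbK.
move=> h; suff /h/eqP : ((c == i) && (r \in [:: gO Gm j; gX Gm j])
    || (c == j) && (r \in [:: gO Gm i; gX Gm i])) by [].
by rewrite /r -e2; case/orP: cd => /andP[/eqP-> /eqP->]; rewrite !inE !eqxx ?orbT.
Qed.

(** A marking whose row lies inside the interval of the other column emits a horizontal segment that
    crosses that strand in G+ or in G-, depending on the side to which it leaves. Positivity in G+
    and negativity in G- then force the same vertical direction; [K1] to [K4] record this for the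
    four markings. *)
Lemma crossing_order : cyclically_ordered (gO Gp j) (gO Gp i) (gX Gp j).
Proof.
have [ji meet contained _ _] := Gpm_cross.
have pij : pair i j by rewrite /pair !eqxx.
have pji : pair j i by rewrite /pair !eqxx orbT.
have kX c d : gX Gp d != gO Gp c -> colX Gp (gO Gp c) != d.
  by apply: contraNneq => <-; rewrite permKV.
have kO c d : gO Gp d != gX Gp c -> colO Gp (gX Gp c) != d.
  by apply: contraNneq => <-; rewrite permKV.
have Oij : gO Gp i != gO Gp j :> nat.
  by rewrite -ord_eqE (inj_eq perm_inj) ord_eqE ji; lia.
have Xij : gX Gp i != gX Gp j :> nat.
  by rewrite -ord_eqE (inj_eq perm_inj) ord_eqE ji; lia.
move: meet contained; rewrite /interiors_meet /interval_contained /col_lo /col_hi => meet contained.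
have OXii := grid_disjoint Gp i; have OXjj := grid_disjoint Gp j.
move: (plusO pij) (plusO pji) (plusX pij) (plusX pji).
move: (minusO pij) (minusO pji) (minusX pij) (minusX pji).
move: (kX i i) (kX i j) (kX j i) (kX j j) (kO i i) (kO i j) (kO j i) (kO j j).
rewrite /cyclically_ordered /strictly_between.
move: OXii OXjj; rewrite !ord_eqE ji.
move: (colX Gp (gO Gp i)) (colX Gp (gO Gp j)) (colO Gp (gX Gp i)) (colO Gp (gX Gp j)).
move: meet contained Oij Xij; move: (gO Gp i) (gO Gp j) (gX Gp i) (gX Gp j).
move=> [u /= _] [l /= _] [w /= _] [v /= _] h1 h2 h3 h4.
move=> [k1 /= _] [k2 /= _] [k3 /= _] [k4 /= _].
move: (nat_of_ord i) => p; clear -h1 h2 h3 h4.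
move=> uw lv ni1 nj1 ni2 nj2 ni3 nj3 ni4 nj4 m1 m2 m3 m4 p2 p1 p4 p3.
have wu : w != u by rewrite eq_sym.
have vl : v != l by rewrite eq_sym.
have K1 : v != u -> (minn v l < u < maxn v l)%N -> ~~ (v < l)%N.
  move=> vu s; move: (ni1 wu) (nj1 vu) => a b; move: (m1 a b s) (p1 s).
  by clear -a b; lia.
have K2 : w != l -> (minn w u < l < maxn w u)%N -> (w < u)%N.
  move=> wl s; move: (ni2 wl) (nj2 vl) => a b; move: (m2 a b s) (p2 s).
  by clear -a b; lia.
have K3 : l != w -> (minn v l < w < maxn v l)%N -> (v < l)%N.
  move=> lw s; move: (ni3 uw) (nj3 lw) => a b; move: (m3 a b s) (p3 s).
  by clear -a b; lia.
have K4 : u != v -> (minn w u < v < maxn w u)%N -> ~~ (w < u)%N.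
  move=> uv s; move: (ni4 uv) (nj4 lv) => a b; move: (m4 a b s) (p4 s).
  by clear -a b; lia.
clear -h1 h2 h3 h4 wu vl K1 K2 K3 K4.
(* The intervals overlap properly, so each has exactly one end inside the other, and the directions
   forced there exclude all other cyclic orders. *)
move: h1 h2 K1 K2 K3 K4; rewrite /minn /maxn.
case: (ltngtP w u) wu => // wu _; case: (ltngtP v l) vl => // vl _;
  do 2 case: ifP; rewrite ?andbT ?andbF /=; lia.
Qed.
End CrossingSign.

(** * Maps given by matrices *)

Section MatrixMaps.
Variable n : nat.
Implicit Types (x y z : 'S_n) (G : grid n) (M : 'S_n -> 'S_n -> VRing n) (v : GC n).

(** Elements act as row vectors: [M x y] is the coefficient of [y] in the image of [x], so
    composition reverses the order of matrix products. *)
Definition apply_matrix M v : GC n := [ffun y => \sum_x (v x : VRing n) * M x y].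

Lemma apply_matrix_is_linear M : linear (apply_matrix M).
Proof.
move=> a v w; apply/ffunP => y; rewrite !ffunE scaler_sumr -big_split.
by apply: eq_bigr => x _; rewrite !ffunE /= mulrDl; congr (_ + _); apply: esym; apply: mulrA.
Qed.

HB.instance Definition _ M :=
  GRing.isLinear.Build (VRing n) (GC n) (GC n) _ (apply_matrix M) (apply_matrix_is_linear M).

Lemma eq_apply_matrix M M' v : (forall x y, M x y = M' x y) ->
  apply_matrix M v = apply_matrix M' v.
Proof. by move=> E; apply/ffunP => y; rewrite !ffunE; apply: eq_bigr => x _; rewrite E. Qed.

Lemma apply_matrix_comp M M' v :
  apply_matrix M' (apply_matrix M v) = apply_matrix (fun x z => \sum_y M x y * M' y z) v.
Proof.
apply/ffunP => z; rewrite !ffunE.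
under eq_bigr => y _ do rewrite ffunE mulr_suml.
rewrite exchange_big; apply: eq_bigr => x _; rewrite mulr_sumr.
by apply: eq_bigr => y _; rewrite mulrA.
Qed.

Lemma apply_matrixD M M' v :
  apply_matrix (fun x y => M x y + M' x y) v = apply_matrix M v + apply_matrix M' v.
Proof.
apply/ffunP => y; rewrite !ffunE -big_split.
by apply: eq_bigr => x _; rewrite mulrDr.
Qed.

Lemma apply_scalar_matrix (a : VRing n) v :
  apply_matrix (fun x z => (x == z)%:R * a) v = a *: v.
Proof.
apply/ffunP => z; rewrite [LHS]ffunE [RHS]ffunE (bigD1 z) //= eqxx mul1r.
rewrite big1 => [|x xz]; last by rewrite (negbTE xz) mul0r mulr0.
by rewrite addr0; apply: (mulrC (v z : VRing n) a).
Qed.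

Lemma scale_ffunE (a : VRing n) v z : (a *: v) z = a * (v z : VRing n) :> VRing n.
Proof. by rewrite [LHS]ffunE. Qed.

Lemma differential_genE G x z : differential_gen G x z = differential_matrix G x z.
Proof.
rewrite /differential_gen sum_ffunE.
transitivity (\sum_y differential_matrix G x y * (z == y)%:R).
  apply: eq_bigr => y _; rewrite sum_ffunE mulr_suml; apply: eq_bigr => Q _.
  by rewrite scale_ffunE [generator _ _]ffunE.
rewrite (bigD1 z) //= eqxx mulr1 big1 ?addr0 // => y yz.
by rewrite eq_sym (negbTE yz) mulr0.
Qed.

Lemma differentialE G v : differential G v = apply_matrix (differential_matrix G) v.
Proof.
apply/ffunP => z; rewrite [RHS]ffunE /differential sum_ffunE; apply: eq_bigr => x _.
by rewrite scale_ffunE differential_genE.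
Qed.

Lemma addrr_GC v : v + v = 0.
Proof.
by rewrite -[v]scale1r -scalerDl VRing_two scale0r.
Qed.

Lemma chain_map_matrix G G' M :
  (forall x z, \sum_y M x y * differential_matrix G' y z =
               \sum_y differential_matrix G x y * M y z) ->
  chain_map G G' (apply_matrix M).
Proof. by move=> MD v; rewrite !differentialE !apply_matrix_comp; apply: eq_apply_matrix. Qed.

Lemma homotopic_matrix G M M' H a :
  homogeneous G G (-1) 0 (apply_matrix H) ->
  (forall x z, \sum_y M x y * M' y z + commutator (differential_matrix G) H x z =
     (x == z)%:R * a) ->
  filtered_homotopic_to_mul G a (apply_matrix M' \o apply_matrix M).
Proof.
move=> Hh E; exists (apply_matrix H); split=> // v.
rewrite !differentialE /= !apply_matrix_comp -(apply_scalar_matrix a v).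
have C : apply_matrix (commutator (differential_matrix G) H) v =
    apply_matrix (fun x z => \sum_y H x y * differential_matrix G y z) v +
    apply_matrix (fun x z => \sum_y differential_matrix G x y * H y z) v.
  rewrite -apply_matrixD; apply: eq_apply_matrix => x z.
  by rewrite /commutator big_split addrC.
rewrite -C -(eq_apply_matrix v E) apply_matrixD opprD addrA subrr add0r.
(* In characteristic two the commutator is its own negative, so its sign in the homotopy formula is
   immaterial. *)
apply: (addIr (apply_matrix (commutator (differential_matrix G) H) v)).
by rewrite addNr addrr_GC.
Qed.

Lemma msupp_sum_exists (I : finType) (P : pred I) (F : I -> VRing n) k :
  k \in msupp (\sum_(i | P i) F i) -> exists2 i, P i & k \in msupp (F i).
Proof.
move=> kS;
have [/existsP[i /andP[Pi ki]]|/existsPn h] :=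
  boolP [exists i, P i && (k \in msupp (F i))].
  by exists i.
move: kS; rewrite mcoeff_msupp raddf_sum big1 ?eqxx //= => i Pi.
by apply/eqP; have := h i; rewrite Pi /= mcoeff_msupp negbK.
Qed.

Lemma mem_msupp_monomial (e : 'I_n -> nat) (p : VRing n) k :
  k \in msupp (p * monomial e) ->
  exists2 k', k' \in msupp p & mdeg k = (\sum_(r < n) e r + mdeg k')%N.
Proof.
have -> : monomial e = 'X_[ [multinom e r | r < n] ].
  by rewrite mpolyXE_id; apply: eq_bigr => r _; rewrite mnmE.
rewrite (perm_mem (msuppMX _ _)) => /mapP[k' kp ->]; exists k' => //.
rewrite mdegD mdegE; congr (_ + _)%N.
by apply: eq_bigr => r _; rewrite mnmE.
Qed.

(** Degrees can be checked on single rectangles: each monomial of the image comes from one rectangle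
    and one monomial of the argument. *)
Lemma homogeneous_rect_sum G G' (e : rect n -> 'I_n -> nat) (P : pred (rect n)) (m t : rat) :
  (forall x y Q, Q \in empty_rects x y -> P Q ->
    maslov G' y - 2 * (\sum_(r < n) e Q r)%:R = maslov G x + m /\
    alexander G' y - (\sum_(r < n) e Q r)%:R <= alexander G x + t) ->
  homogeneous G G' m t (apply_matrix (rect_sum (fun Q => monomial (e Q)) P)).
Proof.
move=> deg.
have E v y k : k \in msupp (apply_matrix (rect_sum (fun Q => monomial (e Q)) P) v y : VRing n) ->
    exists x Q k', [/\ Q \in empty_rects x y, P Q, k' \in msupp (v x : VRing n)
      & mdeg k = (\sum_(r < n) e Q r + mdeg k')%N].
  rewrite ffunE => /msupp_sum_exists[x _]; rewrite mulr_sumr.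
  case/msupp_sum_exists => Q /andP[Qxy PQ] /mem_msupp_monomial[k' kv dk].
  by exists x, Q, k'.
split=> [d|s] v vd y k /E[x [Q [k' [Qxy PQ kv dk]]]]; have [Em Ea] := deg x y Q Qxy PQ.
  have := vd x k' kv; rewrite /maslov_mon dk natrD; move: Em; lra.
have := vd x k' kv; rewrite /alexander_mon dk natrD; move: Ea; lra.
Qed.

End MatrixMaps.

(** * Degrees of the crossing change maps and of the homotopies *)

Section Degrees.
Variables (n : nat) (Gp Gm : grid n) (i j : 'I_n).
Hypothesis ji : nat_of_ord j = i.+1.
Hypothesis GmO : forall c, gO Gm c = gO Gp (tperm i j c).
Hypothesis GmX : forall c, gX Gm c = gX Gp (tperm i j c).
Hypothesis order : cyclically_ordered (gO Gp j) (gO Gp i) (gX Gp j).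
Implicit Types (x y : 'S_n) (Q : rect n) (G : grid n).

Let u := gO Gp i.
Let l := gO Gp j.
Let v := gX Gp j.
Let w := gX Gp i.

Lemma hits_rows G Q : hits (gO G) Q = (\sum_(r < n) square_in Q (colO G r) r)%N.
Proof.
rewrite /hits (reindex_inj (@perm_inj _ ((gO G)^-1)%g)); apply: eq_bigr => r _.
by rewrite permKV.
Qed.

Lemma maslov_rect G x y Q : Q \in empty_rects x y ->
  maslov G y = maslov G x - 1 + 2 * (hits (gO G) Q)%:R.
Proof. by move/(Mfun_rect (gO G)); rewrite /maslov; lra. Qed.

Lemma alexander_rect G x y Q : Q \in empty_rects x y ->
  alexander G y = alexander G x + (hits (gO G) Q)%:R - (hits (gX G) Q)%:R.
Proof.
move=> Qxy; rewrite /alexander.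
by move: (Mfun_rect (gO G) Qxy) (Mfun_rect (gX G) Qxy); lra.
Qed.

(** The homotopies are parts of a differential, so they inherit its degree; the X's in a rectangle
    can only lower the filtration level. *)
Lemma differential_part_homogeneous G c d r :
  homogeneous G G (-1) 0 (apply_matrix (straddle_matrix r G c d)).
Proof.
apply: homogeneous_rect_sum => x y Q Qxy _; rewrite -hits_rows.
rewrite (maslov_rect G Qxy) (alexander_rect G Qxy); split; first by lra.
by rewrite addr0; have := ler0n rat (hits (gX G) Q); lra.
Qed.

Lemma maslov_minus x : maslov Gm x = maslov Gp x
  + 2 * ((u < x j)%N%:R - (l < x j)%N%:R) + 1 - 2 * (u < l)%N%:R.
Proof.
have -> : maslov Gm x = Mfun (swapped (gO Gp) i j) x.
  by congr Mfun; apply/permP => c; rewrite GmO permM.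
by have := Mfun_columns_swapped (gO Gp) x ji; rewrite /maslov -/u -/l; lra.
Qed.

Lemma MfunX_minus x : Mfun (gX Gm) x = Mfun (gX Gp) x
  + 2 * ((w < x j)%N%:R - (v < x j)%N%:R) + 1 - 2 * (w < v)%N%:R.
Proof.
have -> : gX Gm = swapped (gX Gp) i j by apply/permP => c; rewrite GmX permM.
by have := Mfun_columns_swapped (gX Gp) x ji; rewrite -/w -/v; lra.
Qed.

(** Here the cyclic order of the three markings enters: it turns the planar correction in
    [maslov_minus] into the arcs of [down_degree] and [up_degree]. *)
Lemma arc_order (e : 'I_n) :
  (arc e v u + (u < e) = arc e v l + (l < e) + (u < l))%N.
Proof.
by move: order; rewrite /cyclically_ordered => o; rewrite !arc_add_lt ?ord_eqE /u /l /v; lia.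
Qed.

Lemma sum_split (f : 'I_n -> nat) :
  (\sum_(r < n) f r = f u + f l + \sum_(r | (r != u) && (r != l)) f r)%N.
Proof.
by rewrite (bigD1 u) //= (bigD1 l) 1?eq_sym ?(neq_ul Gp ji) // addnA.
Qed.

Lemma hits_split Q : hits (gO Gp) Q = (square_in Q i u + square_in Q j l
  + \sum_(r | (r != u) && (r != l)) square_in Q (colO Gp r) r)%N.
Proof. by rewrite hits_rows sum_split /u /l colO_u colO_l. Qed.

Lemma down_degree x y Q : Q \in empty_rects x y -> crosses i j v Q ->
  (\sum_(r < n) down_exp Gp i j v Q r + arc (y j) v u = hits (gO Gp) Q + arc (y j) v l)%N.
Proof.
move=> Qxy cQ; rewrite hits_split sum_split.
have -> : (\sum_(r | (r != u) && (r != l)) down_exp Gp i j v Q r =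
    \sum_(r | (r != u) && (r != l)) square_in Q (colO Gp r) r)%N.
  apply: eq_bigr => r /andP[ru rl]; rewrite /down_exp -/u -/l (negbTE ru) (negbTE rl).
  by case: Q {Qxy cQ} => [[? ?] [? ?]].
have lu : (l == u) = false by apply/negbTE; rewrite eq_sym (neq_ul Gp ji).
case/orP: cQ => h.
  have [e1 e2 si /(_ l)] := left_straddle ji Qxy h; rewrite si.
  case: Q {Qxy h si} e1 e2 => [[? p] [? s]] /= -> ->; rewrite -/u -/l !eqxx lu.
  by case: arc; case: arc; case: arc; case: square_in; lia.
have [e1 e2 si /(_ u)] := right_straddle ji Qxy h; rewrite si.
case: Q {Qxy h si} e1 e2 => [[? p] [? s]] /= -> ->; rewrite -/u -/l !eqxx lu.
by case: arc; case: arc; case: arc; case: square_in; lia.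
Qed.

Lemma up_degree x y Q : Q \in empty_rects x y -> crosses i j v Q ->
  (\sum_(r < n) up_exp Gp i j v Q r + arc (x j) v l = hits (gO Gp) Q + arc (x j) v u)%N.
Proof.
move=> Qxy cQ; rewrite hits_split sum_split.
have -> : (\sum_(r | (r != u) && (r != l)) up_exp Gp i j v Q r =
    \sum_(r | (r != u) && (r != l)) square_in Q (colO Gp r) r)%N.
  apply: eq_bigr => r /andP[ru rl]; rewrite /up_exp -/u -/l (negbTE ru) (negbTE rl).
  by case: Q {Qxy cQ} => [[? ?] [? ?]].
have lu : (l == u) = false by apply/negbTE; rewrite eq_sym (neq_ul Gp ji).
case/orP: cQ => h.
  have [e1 e2 si /(_ l)] := left_straddle ji Qxy h; rewrite si.
  case: Q {Qxy h si} e1 e2 => [[? p] [? s]] /= -> ->; rewrite -/u -/l !eqxx lu.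
  by case: arc; case: arc; case: arc; case: square_in; lia.
have [e1 e2 si /(_ u)] := right_straddle ji Qxy h; rewrite si.
case: Q {Qxy h si} e1 e2 => [[? p] [? s]] /= -> ->; rewrite -/u -/l !eqxx lu.
by case: arc; case: arc; case: arc; case: square_in; lia.
Qed.

Lemma le_hitsX Q : (square_in Q i w + square_in Q j v <= hits (gX Gp) Q)%N.
Proof.
rewrite /hits (bigD1 i) //= (bigD1 j) 1?eq_sym ?(neq_ij ji) //= -/w -/v addnA.
exact: leq_addr.
Qed.

(** A left rectangle contains the X in row [v] of column [j]; for a right one, the arc from [y j] to
    [v] controls the X in row [w] of column [i]. *)
Lemma down_hitsX x y Q : Q \in empty_rects x y -> crosses i j v Q ->
  ((v < y j) + (w < v) <= hits (gX Gp) Q + (w < y j))%N.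
Proof.
move=> Qxy cQ; have := le_hitsX Q; have wv : w != v by rewrite (inj_eq perm_inj) (neq_ij ji).
case/orP: cQ => h.
  by case/andP: h => -> _; move: (square_in _ _ _) (hits _ _); lia.
have [_ _ sj /(_ w)] := right_straddle ji Qxy h; rewrite sj.
by have := arc_add_lt (y j) wv; lia.
Qed.

Lemma up_hitsX x y Q : Q \in empty_rects x y -> crosses i j v Q ->
  (1 + (w < x j) <= hits (gX Gp) Q + (v < x j) + (w < v))%N.
Proof.
move=> Qxy cQ; have := le_hitsX Q; have wv : w != v by rewrite (inj_eq perm_inj) (neq_ij ji).
case/orP: cQ => h.
  by case/andP: h => -> _; move: (square_in _ _ _) (hits _ _); lia.
have [_ _ sj /(_ w)] := right_straddle ji Qxy h; rewrite sj.
by have := arc_add_lt (x j) wv; lia.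
Qed.

Lemma down_homogeneous : homogeneous Gp Gm 0 0 (apply_matrix (down_matrix Gp i j v)).
Proof.
apply: homogeneous_rect_sum => x y Q Qxy cQ.
have := congr1 (fun d : nat => d%:R : rat) (down_degree Qxy cQ).
have := congr1 (fun d : nat => d%:R : rat) (arc_order (y j)).
have := down_hitsX Qxy cQ; rewrite -(ler_nat rat) /alexander !natrD.
have := maslov_minus y; have := MfunX_minus y; have := maslov_rect Gp Qxy.
have := Mfun_rect (gX Gp) Qxy; rewrite /maslov; move=> *; split; lra.
Qed.

Lemma up_homogeneous : homogeneous Gm Gp (- 2) (-1) (apply_matrix (up_matrix Gp i j v)).
Proof.
apply: homogeneous_rect_sum => x y Q Qxy cQ.
have := congr1 (fun d : nat => d%:R : rat) (up_degree Qxy cQ).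
have := congr1 (fun d : nat => d%:R : rat) (arc_order (x j)).
have := up_hitsX Qxy cQ; rewrite -(ler_nat rat) /alexander !natrD.
have := maslov_minus x; have := MfunX_minus x; have := maslov_rect Gp Qxy.
have := Mfun_rect (gX Gp) Qxy; rewrite /maslov; move=> *; split; lra.
Qed.

End Degrees.

Theorem theorem1p2 (n : nat) (Gp Gm : grid n) (i j : 'I_n)
    (Gp_knot : is_knot Gp) (Gm_knot : is_knot Gm)
    (Gpm_cross : cross_commutation Gp Gm i j)
    (Gpm_sign : changes_positive_crossing Gp Gm i j) :
  exists (Cm Cp : {linear GC n -> GC n}),
    [/\ chain_map Gp Gm Cm /\ filtered Gp Gm Cm,
        chain_map Gm Gp Cp /\ filtered Gm Gp Cp,
        homogeneous Gp Gm 0 0 Cm,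
        homogeneous Gm Gp (-2%:R) (-1) Cp
      & filtered_homotopic_to_mul Gm 'X_(upperO Gp i j) (Cm \o Cp) /\
        filtered_homotopic_to_mul Gp 'X_(upperO Gp i j) (Cp \o Cm)].
Proof.
have [ji _ _ GmO GmX] := Gpm_cross.
have order := crossing_order Gpm_cross Gpm_sign.
(* The field of fractions serves as [K]. *)
have inj : injective (@tofrac (VRing n)) by move=> p q /eqP; rewrite tofrac_eq => /eqP.
have down_hom := down_homogeneous ji GmO GmX order.
have up_hom := up_homogeneous ji GmO GmX order.
exists (apply_matrix (down_matrix Gp i j (gX Gp j))),
  (apply_matrix (up_matrix Gp i j (gX Gp j))).
split=> //.
- split; first by apply: chain_map_matrix; apply: (down_chain _ ji GmO inj).
  by move=> s v /down_hom.2; rewrite addr0.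
- split; first by apply: chain_map_matrix; apply: (up_chain _ ji GmO inj).
  move=> s v /up_hom.2 h x k /h; lra.
(* Each composite is homotopic to both $V_u$ and $V_l$; the case tells which of them belongs to the
   upper O, and thus which part of the differential is the homotopy. *)
- rewrite /upperO; case: ifP => _; split.
  + apply: (homotopic_matrix (differential_part_homogeneous _ i j (gX Gp j))).
    exact: (up_down_right _ ji GmO inj).
  + apply: (homotopic_matrix (differential_part_homogeneous _ j i (gX Gp j))).
    exact: (down_up_left _ _ ji inj).
  + apply: (homotopic_matrix (differential_part_homogeneous _ j i (gX Gp j))).
    exact: (up_down_left _ ji GmO inj).
  + apply: (homotopic_matrix (differential_part_homogeneous _ i j (gX Gp j))).
    exact: (down_up_right _ _ ji inj).
Qed.
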